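(* Let $k\ge1$. Suppose that $f$ is a $k$-regular function on a neighborhood of a point $q_0\in\mathcal S$ in $\mathbb H^{n+1}$. Then $(\psi\circ\mathcal F)^*f=f\circ\psi\circ\mathcal F$ is $k$-CF on $\mathscr H$ near the point $\mathcal F^{-1}(\pi(q_0))$.
   Context: The right quaternionic Heisenberg group is $\mathscr H=\mathbb H^n\times\operatorname{Im}\mathbb H\cong\mathbb R^{4n}\times\mathbb R^3$ with multiplication $(x,t)\cdot(y,s)=(x+y,\,t+s+2\operatorname{Im}(x\overline y))$, $x\overline y=\sum_l x_l\overline{y_l}$. In real coordinates $(y_1,\dots,y_{4n},s_1,s_2,s_3)$ it has left invariant vector fields $$Y_{4l+j}=\frac{\partial}{\partial y_{4l+j}}+2\sum_{\beta=1}^3\sum_{m=1}^4 B^\beta_{mj}\,y_{4l+m}\frac{\partial}{\partial s_\beta},\qquad l=0,\dots,n-1,\ j=1,\dots,4,$$ $$B^1=\begin{pmatrix}0&-1&0&0\\1&0&0&0\\0&0&0&-1\\0&0&1&0\end{pmatrix},\quad B^2=\begin{pmatrix}0&0&-1&0\\0&0&0&1\\1&0&0&0\\0&-1&0&0\end{pmatrix},\quad B^3=\begin{pmatrix}0&0&0&-1\\0&0&-1&0\\0&1&0&0\\1&0&0&0\end{pmatrix},$$ and $Z_{2l}^{0'}=-Y_{4l+3}-\mathbf iY_{4l+4}$, $Z_{2l}^{1'}=-Y_{4l+1}-\mathbf iY_{4l+2}$, $Z_{2l+1}^{0'}=Y_{4l+1}-\mathbf iY_{4l+2}$, $Z_{2l+1}^{1'}=-Y_{4l+3}+\mathbf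 iY_{4l+4}$. Elements of $\odot^k\mathbb C^2$ are tuples $(f_{A_1'\cdots A_k'})$, $A_i'\in\{0',1'\}$, symmetric in the indices. A $\odot^k\mathbb C^2$-valued distribution $g$ on an open subset of $\mathscr H$ is $k$-CF if, in the sense of distributions, $\sum_{A_1'=0',1'}Z_A^{A_1'}g_{A_1'A_2'\cdots A_k'}=0$ for all $A=0,\dots,2n-1$ and $A_2',\dots,A_k'\in\{0',1'\}$. On $\mathbb H^{n+1}$ use real coordinates $x_1,\dots,x_{4n+4}$ with $q_{l+1}=x_{4l+1}+\mathbf ix_{4l+2}+\mathbf jx_{4l+3}+\mathbf kx_{4l+4}$, $l=0,\dots,n$, and $q'=(q_1,\dots,q_n)$. Let $\nabla_{2l}^{0'}=-\partial_{x_{4l+3}}-\mathbf i\partial_{x_{4l+4}}$, $\nabla_{2l}^{1'}=-\partial_{x_{4l+1}}-\mathbf i\partial_{x_{4l+2}}$, $\nabla_{2l+1}^{0'}=\partial_{x_{4l+1}}-\mathbf i\partial_{x_{4l+2}}$, $\nabla_{2l+1}^{1'}=-\partial_{x_{4l+3}}+\mathbf i\partial_{x_{4l+4}}$, for $l=0,\dots,n$. A $\odot^k\mathbb C^2$-valued distribution $f$ on an open subset of $\mathbb H^{n+1}$ is $k$-regular if, in the sense of distributions, $\sum_{B'=0',1'}\nabla_A^{B'}f_{B'A_2'\cdots A_k'}=0$ for all $A=0,\dots,2n+1$ and all $A_2',\dots,A_k'$ (such $f$ are smooth functions, so the composition is defined). The hypersurface is $\mathcal S=\{(q',q_{n+1})\in\mathbb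 H^{n}\times\mathbb H:\operatorname{Re}q_{n+1}=\phi(q')\}$ with $\phi(q')=\sum_{l=0}^{n-1}(-3x_{4l+1}^2+x_{4l+2}^2+x_{4l+3}^2+x_{4l+4}^2)$. The map $\pi:\mathcal S\to\mathbb H^n\times\operatorname{Im}\mathbb H\cong\mathbb R^{4n+3}$ is $\pi(q',\phi(q')+\mathbf t)=(q',\mathbf t)$, $\mathbf t=t_1\mathbf i+t_2\mathbf j+t_3\mathbf k$, and $\psi=\pi^{-1}$. The map $\mathcal F:\mathscr H\to\mathbb R^{4n+3}$, $(y,s)\mapsto(x,t)$, is $$x_{4l+j}=y_{4l+j},\qquad t_\beta=s_\beta+\sum_{l=0}^{n-1}\sum_{m,j=1}^4D^\beta_{mj}\,y_{4l+m}y_{4l+j},\qquad D^\beta=\tfrac12\left(C^\beta+(C^\beta)^t\right),$$ where $$C^1=\begin{pmatrix}0&-3&0&0\\-1&0&0&0\\0&0&0&-1\\0&0&1&0\end{pmatrix},\quad C^2=\begin{pmatrix}0&0&-3&0\\0&0&0&1\\-1&0&0&0\\0&-1&0&0\end{pmatrix},\quad C^3=\begin{pmatrix}0&0&0&-3\\0&0&-1&0\\0&1&0&0\\-1&0&0&0\end{pmatrix}.$$ *)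

(* Defs.v *)
From HB Require Import structures.
From mathcomp Require Import all_boot all_order all_algebra.
From mathcomp Require Import complex.
From mathcomp Require Import all_classical all_reals all_analysis.
From mathcomp Require Import zify.

Set Implicit Arguments.
Unset Strict Implicit.
Unset Printing Implicit Defensive.

Import Order.TTheory GRing.Theory Num.Theory.
Import numFieldNormedType.Exports.

Local Open Scope classical_set_scope.
Local Open Scope ring_scope.

(** * Distributions on open subsets of R^N *)

Section Distributions.
Variable R : realType.

Section FixedDimension.
Variable N : nat.
Implicit Types (U K : set 'rV[R]_N) (phi psi : 'rV[R]_N -> R).

Definition partial (i : 'I_N) phi : 'rV[R]_N -> R :=
  fun x => 'D_(delta_mx 0 i) phi x.

Definition partials (s : seq 'I_N) phi : 'rV[R]_N -> R :=
  foldr partial phi s.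

(** [C^oo] on the open set [U]: every iterated partial derivative is Fréchet
    differentiable (in particular continuous) at every point of [U]. *)
Definition smooth_on U phi : Prop :=
  forall (s : seq 'I_N) (x : 'rV[R]_N), U x -> differentiable (partials s phi) x.

Definition csmooth_on U (g : 'rV[R]_N -> R[i]) : Prop :=
  smooth_on U (fun x => complex.Re (g x)) /\
  smooth_on U (fun x => complex.Im (g x)).

Definition vanishes_off K phi : Prop := forall x, ~ K x -> phi x = 0.

Definition test_function U phi : Prop :=
  smooth_on setT phi /\
  exists K, [/\ compact K, K `<=` U & vanishes_off K phi].

(** Complex-valued distributions are R-linear forms on real-valued test
    functions (equivalently, by complexification, C-linear forms on
    complex-valued ones).  They are represented by total functions, whose values
    outside the test functions are irrelevant. *)
Definition functional : Type := ('rV[R]_N -> R) -> R[i].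

(** Continuity on [C_c^oo(U)] is the usual family of seminorm estimates
    [|T phi| <= C * max_(|a| <= m) sup |d^a phi|], one for each compact set
    supporting [phi]; [M] is any bound of the maximum. *)
Definition is_distribution U (T : functional) : Prop :=
  (forall (a : R) phi psi, test_function U phi -> test_function U psi ->
     T (fun x => a * phi x + psi x) = a%:C%C * T phi + T psi) /\
  (forall K, compact K -> K `<=` U ->
     exists (C : R) (m : nat), forall phi (M : R),
       smooth_on setT phi -> vanishes_off K phi ->
       (forall (s : seq 'I_N) x, (size s <= m)%N -> `|partials s phi x| <= M) ->
       `|T phi| <= (C * M)%:C%C).

Definition dpartial (i : 'I_N) (T : functional) : functional :=
  fun phi => - T (partial i phi).

Definition dmul (a : 'rV[R]_N -> R) (T : functional) : functional :=
  fun phi => T (fun x => a x * phi x).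

(** Given the first order operators [D j], [j = 0, .., 3] (standing for the
    paper's indices [1, .., 4]), the operator of index [2 l + e] and upper index
    [b'], where [false] and [true] stand for [0] and [1]. *)
Definition spinor_op (D : 'I_4 -> functional -> functional) (e b : bool)
    (T : functional) : functional := fun phi =>
  let d j := D j T phi in
  match e, b with
  | false, false => - d (@Ordinal 4 2 isT) - 'i%C * d (@Ordinal 4 3 isT)
  | false, true  => - d (@Ordinal 4 0 isT) - 'i%C * d (@Ordinal 4 1 isT)
  | true,  false =>   d (@Ordinal 4 0 isT) - 'i%C * d (@Ordinal 4 1 isT)
  | true,  true  => - d (@Ordinal 4 2 isT) + 'i%C * d (@Ordinal 4 3 isT)
  end.

(** Distributions with values in the symmetric power of order [k] of [C^2];
    the primed indices [0'], [1'] are [false], [true]. *)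
Definition is_spinor_distribution (k : nat) U
    (T : k.-tuple bool -> functional) : Prop :=
  (forall A, is_distribution U (T A)) /\
  (forall A B : k.-tuple bool, perm_eq A B ->
     forall phi, test_function U phi -> T A phi = T B phi).

End FixedDimension.

(** Iterated Lebesgue integral over R^N; by Fubini this is the Lebesgue integral
    for the continuous compactly supported functions it is applied to. *)
Fixpoint integral_rV (N : nat) : ('rV[R]_N -> R) -> R :=
  match N return ('rV[R]_N -> R) -> R with
  | 0%N => fun h => h 0
  | N'.+1 => fun h => Rintegral (@lebesgue_measure R) setT
      (fun t : R => integral_rV (fun v : 'rV[R]_N' =>
         h (row_mx (t%:M : 'rV[R]_1) v)))
  end.

Definition function_distribution (N : nat) (g : 'rV[R]_N -> R[i]) :
    functional N := fun phi =>
  (integral_rV (fun x => complex.Re (g x) * phi x)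
   +i* integral_rV (fun x => complex.Im (g x) * phi x))%C.

End Distributions.

(** * Regular functions on H^(n+1) and CF functions on the Heisenberg group *)

Section QuaternionicHeisenberg.
Variable R : realType.
Variable n : nat.

(** All coordinate indices start at 0: the paper's [x_(4l+j)], [j = 1, .., 4], is
    the coordinate of index [4 * l + (j - 1)], and likewise for [s_beta]. *)

Fact yidx_subproof (l : 'I_n) (j : 'I_4) : (4 * l + j < 4 * n)%N.
Proof. by have := ltn_ord l; have := ltn_ord j; lia. Qed.

Definition yidx (l : 'I_n) (j : 'I_4) : 'I_(4 * n) :=
  Ordinal (yidx_subproof l j).

Fact xidx_subproof (l : 'I_n.+1) (j : 'I_4) : (4 * l + j < 4 * n + 4)%N.
Proof. by have := ltn_ord l; have := ltn_ord j; lia. Qed.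

Definition xidx (l : 'I_n.+1) (j : 'I_4) : 'I_(4 * n + 4) :=
  Ordinal (xidx_subproof l j).

(** [Hn1] is H^(n+1), a row being the concatenation of [q'] and [q_(n+1)];
    [Heis] is [H^n x Im H], a row being the concatenation of [y] and [s]. *)
Definition Hn1 : Type := 'rV[R]_(4 * n + 4).
Definition Heis : Type := 'rV[R]_(4 * n + 3).

Definition int_mx4 (rows : seq (seq int)) : 'M[R]_4 :=
  \matrix_(i, j) (((nth [::] rows i)`_j)%:~R).

Definition Bmx (beta : 'I_3) : 'M[R]_4 :=
  nth 0 [:: int_mx4 [:: [:: 0; -1;  0;  0];
                        [:: 1;  0;  0;  0];
                        [:: 0;  0;  0; -1];
                        [:: 0;  0;  1;  0]];
            int_mx4 [:: [:: 0;  0; -1;  0];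
                        [:: 0;  0;  0;  1];
                        [:: 1;  0;  0;  0];
                        [:: 0; -1;  0;  0]];
            int_mx4 [:: [:: 0;  0;  0; -1];
                        [:: 0;  0; -1;  0];
                        [:: 0;  1;  0;  0];
                        [:: 1;  0;  0;  0]]] beta.

Definition Cmx (beta : 'I_3) : 'M[R]_4 :=
  nth 0 [:: int_mx4 [:: [:: 0; -3;  0;  0];
                        [:: -1; 0;  0;  0];
                        [:: 0;  0;  0; -1];
                        [:: 0;  0;  1;  0]];
            int_mx4 [:: [:: 0;  0; -3;  0];
                        [:: 0;  0;  0;  1];
                        [:: -1; 0;  0;  0];
                        [:: 0; -1;  0;  0]];
            int_mx4 [:: [:: 0;  0;  0; -3];
                        [:: 0;  0; -1;  0];
                        [:: 0;  1;  0;  0];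
                        [:: -1; 0;  0;  0]]] beta.

Definition Dmx (beta : 'I_3) : 'M[R]_4 := 2^-1 *: (Cmx beta + (Cmx beta)^T).

Definition Y (l : 'I_n) (j : 'I_4) (T : functional R (4 * n + 3)) :
    functional R (4 * n + 3) := fun phi =>
  dpartial (lshift 3 (yidx l j)) T phi
  + 2 * \sum_(beta < 3) \sum_(m < 4)
      (Bmx beta m j)%:C%C *
      dmul (fun p => p 0 (lshift 3 (yidx l m)))
           (dpartial (rshift (4 * n) beta) T) phi.

Definition Z (l : 'I_n) : bool -> bool ->
    functional R (4 * n + 3) -> functional R (4 * n + 3) :=
  spinor_op (Y l).

Definition nabla (l : 'I_n.+1) : bool -> bool ->
    functional R (4 * n + 4) -> functional R (4 * n + 4) :=
  spinor_op (fun j => dpartial (xidx l j)).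

(** The order [k >= 1] of the paper is [k.+1] here; the unprimed index [A] of the
    paper is [2 l + e]. *)
Definition k_CF (k : nat) (V : set Heis)
    (T : k.+1.-tuple bool -> functional R (4 * n + 3)) : Prop :=
  is_spinor_distribution V T /\
  forall (l : 'I_n) (e : bool) (A : k.-tuple bool) phi, test_function V phi ->
    \sum_(b : bool) Z l e b (T [tuple of b :: A]) phi = 0.

Definition k_regular (k : nat) (U : set Hn1)
    (T : k.+1.-tuple bool -> functional R (4 * n + 4)) : Prop :=
  is_spinor_distribution U T /\
  forall (l : 'I_n.+1) (e : bool) (A : k.-tuple bool) phi, test_function U phi ->
    \sum_(b : bool) nabla l e b (T [tuple of b :: A]) phi = 0.

Definition quad_phi (q' : 'rV[R]_(4 * n)) : R :=
  \sum_(l < n) (- 3 * q' 0 (yidx l (@Ordinal 4 0 isT)) ^+ 2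
                + q' 0 (yidx l (@Ordinal 4 1 isT)) ^+ 2
                + q' 0 (yidx l (@Ordinal 4 2 isT)) ^+ 2
                + q' 0 (yidx l (@Ordinal 4 3 isT)) ^+ 2).

(** The last quaternion [rsubmx q] has real part its entry 0, and imaginary part
    the three other ones. *)
Definition hypersurface : set Hn1 :=
  [set q | rsubmx q 0 0 = quad_phi (lsubmx q)].

(** Total on [Hn1]; only its restriction to [hypersurface] is meaningful. *)
Definition pi_S (q : Hn1) : Heis :=
  row_mx (lsubmx q) (@rsubmx R 1 1 3 (rsubmx q)).

Definition psi_S (z : Heis) : Hn1 :=
  row_mx (lsubmx z)
    (row_mx ((quad_phi (lsubmx z))%:M : 'rV[R]_1) (rsubmx z) : 'rV[R]_4).

Definition quad_D (y : 'rV[R]_(4 * n)) : 'rV[R]_3 :=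
  \row_(beta < 3) \sum_(l < n) \sum_(m < 4) \sum_(j < 4)
    Dmx beta m j * y 0 (yidx l m) * y 0 (yidx l j).

Definition calF (p : Heis) : Heis :=
  row_mx (lsubmx p) (rsubmx p + quad_D (lsubmx p)).

Definition calF_inv (z : Heis) : Heis :=
  row_mx (lsubmx z) (rsubmx z - quad_D (lsubmx z)).

Lemma calFK : cancel calF calF_inv.
Proof.
move=> p; rewrite /calF_inv /calF row_mxKl row_mxKr addrK.
exact: (hsubmxK p).
Qed.

Lemma calF_invK : cancel calF_inv calF.
Proof.
move=> p; rewrite /calF_inv /calF row_mxKl row_mxKr subrK.
exact: (hsubmxK p).
Qed.

Lemma psi_S_hypersurface (z : Heis) : hypersurface (psi_S z).
Proof.
rewrite /hypersurface /= /psi_S row_mxKl row_mxKr.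
rewrite -[X in _ = X](_ : ((quad_phi (lsubmx z))%:M : 'rV[R]_1) 0 0 = _);
  last by rewrite mxE eqxx mulr1n.
rewrite -(@row_mxEl R 1 1 3 _ (rsubmx z)).
by congr (_ _ _); apply/val_inj.
Qed.

Lemma psi_SK : cancel psi_S pi_S.
Proof.
move=> z; rewrite /pi_S /psi_S row_mxKl row_mxKr row_mxKr.
exact: (hsubmxK z).
Qed.

Lemma pi_SK : {in hypersurface, cancel pi_S psi_S}.
Proof.
move=> q; rewrite inE /hypersurface /= => Sq.
rewrite /psi_S /pi_S row_mxKl row_mxKr -Sq.
have -> : ((rsubmx q 0 0)%:M : 'rV[R]_1) = @lsubmx R 1 1 3 (rsubmx q).
  apply/matrixP => i j; rewrite !ord1 [LHS]mxE eqxx mulr1n [RHS]mxE.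
  by congr (rsubmx q _ _); apply/val_inj.
rewrite (@hsubmxK R 1 1 3 (rsubmx q)).
exact: (hsubmxK q).
Qed.

End QuaternionicHeisenberg.

(* Main.v *)
(** Idea: a distribution given by a C^1 function satisfies a first order equation
    iff the function satisfies it pointwise (integrate by parts, and test against
    bump functions), so both notions can be compared pointwise.  Under
    [psi_S \o calF] the field [Y_(4l+j)] is pushed forward to [d/dx_(4l+j)] plus a
    combination of the derivatives in [q_(n+1)], and [D^beta] is chosen so that
    [2 B^beta + 2 D^beta = 2 C^beta].  This makes [Z_A^(b)] push forward to
    [nabla_A^(b) + u nabla_(2n)^(b) + v nabla_(2n+1)^(b)] with [u], [v] independent
    of the primed index [b]; contracting with [b], each of the three terms
    annihilates [f].

    Since [integral_rV] is an iterated integral, everything about it is proved by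
    induction on the dimension; a tube lemma gives the continuity and the
    differentiability of the inner integral in the outer variable. *)

Require Import Defs.
From mathcomp Require Import all_boot all_order all_algebra.
From mathcomp Require Import complex.
From mathcomp Require Import all_classical all_reals all_analysis.
From mathcomp Require Import ring lra zify.

Set Implicit Arguments.
Unset Strict Implicit.
Unset Printing Implicit Defensive.

Import Order.TTheory GRing.Theory Num.Theory.
Import numFieldNormedType.Exports.

Local Open Scope classical_set_scope.
Local Open Scope ring_scope.

(** * Integrals on the line *)

Section OneDimensional.
Variable R : realType.
Implicit Types (B : R) (g h : R -> R).
Local Notation mu := (@lebesgue_measure R).
Local Notation Int := (Rintegral mu setT).

(** The image of [psi_S \o calF] is the hypersurface, a null set of H^(n+1), so the weak equations
    of [f] say nothing directly about its restriction; this is what forces the passage through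
    values. The coefficients [u], [v] come from tangency: nabla_A^(b) + u nabla_(2n)^(b) + v
    nabla_(2n+1)^(b) must kill Re q_(n+1) - phi for both values of b. These two equations give u = -
    nabla_A^(1) phi and v = nabla_A^(0) phi. Along the hypersurface the resulting fields have
    coefficients 2 C^beta, linear in the coordinates. A quadratic shear of t changes C^beta by a
    symmetric matrix: it can remove the symmetric part D^beta, and what remains has to be the
    antisymmetric B^beta of the group. For phi a sum of a_j x_(4l+j)^2 this means a_1 + a_j = -2 and
    a_i + a_j = 2 for distinct i, j in {2, 3, 4}, whose solution is (-3, 1, 1, 1). *)

Lemma lebesgue_measure_segment (a b : R) : a < b -> fine (mu `[a, b]) = b - a.
Proof.
move=> ab; have := @lebesgue_measure_itv R `[a, b].
by rewrite /= lte_fin ab => ->.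
Qed.

(** Compact support is carried by a bound [B]: on the segment it defines, continuity alone gives
    integrability. *)
Lemma Rintegral_setT_segment B g : (forall t, B < `|t| -> g t = 0) ->
  Int g = Rintegral mu `[- B, B] g.
Proof.
move=> g0; rewrite [RHS]Rintegral_mkcond; apply: eq_Rintegral => t _.
rewrite patchE; case: ifPn => //; rewrite notin_setE /= in_itv /= => /negP.
by rewrite -ler_norml -ltNge; exact: g0.
Qed.

Lemma integrable_segment B g : continuous g ->
  mu.-integrable `[- B, B] (EFin \o g).
Proof.
move=> cg; apply: continuous_compact_integrable; first exact: segment_compact.
exact: continuous_subspaceT.
Qed.

Lemma Rintegral_linear B (a : R) g h : continuous g -> continuous h ->
  (forall t, B < `|t| -> g t = 0) -> (forall t, B < `|t| -> h t = 0) ->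
  Int (fun t => a * g t + h t) = a * Int g + Int h.
Proof.
move=> cg ch g0 h0.
rewrite (@Rintegral_setT_segment B) => [|t Bt]; last first.
  by rewrite g0 // h0 // mulr0 addr0.
rewrite (@Rintegral_setT_segment B) // (@Rintegral_setT_segment B h) //.
rewrite RintegralD //; last exact: integrable_segment.
- by rewrite RintegralZl //; exact: integrable_segment.
- have := @integrable_segment B (fun t => a * g t).
  by apply => t; apply: cvgM; [exact: cvg_cst | exact: cg].
Qed.

Lemma Rintegral_bound B (M : R) g : 0 < B -> continuous g ->
  (forall t, B < `|t| -> g t = 0) -> (forall t, `|g t| <= M) ->
  `|Int g| <= 2 * B * M.
Proof.
move=> B0 cg g0 gM; rewrite (@Rintegral_setT_segment B) //.
apply: le_trans (le_normr_Rintegral _ _) _ => //; first exact: integrable_segment.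
apply: (@le_trans _ _ (Rintegral mu `[- B, B] (cst M))).
  apply: le_Rintegral => //.
  - apply: (@integrable_segment B (fun t => `|g t|)) => t.
    exact: (cvg_norm (cg t)).
  - by apply: integrable_segment => t; exact: cvg_cst.
rewrite Rintegral_cst // lebesgue_measure_segment; last lra.
by rewrite opprK mulrC -mulr2n mulr_natl.
Qed.

(** By continuity [g] stays above [g c / 2] on a segment of positive length around [c]; elsewhere it
    contributes a nonnegative amount. *)
Lemma Rintegral_gt0 B g (c : R) : 0 < B -> continuous g ->
  (forall t, B < `|t| -> g t = 0) -> (forall t, 0 <= g t) -> 0 < g c ->
  0 < Int g.
Proof.
move=> B0 cg g0 gge0 gc.
have cB : `|c| <= B.
  by rewrite leNgt; apply/negP => /g0 gc0; rewrite gc0 ltxx in gc.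
have [d d0 dg] : exists2 d : R, 0 < d & forall t, `|t - c| < d -> g c / 2 < g t.
  have : \forall t \near c, g c / 2 < g t.
    by apply: (cvgr_gt (g c) (cg c)); rewrite ltr_pdivrMr //; lra.
  move=> /nbhs_ballP[d /= d0 dg]; exists d => // t tc; apply: dg.
  by rewrite /ball /= distrC.
pose a := c - d / 2; pose b := c + d / 2.
have intg D : measurable D -> mu.-integrable D (EFin \o g).
  move=> mD; apply: (@integrableS _ _ _ mu setT) => //.
  have := (@integrable_mkcond _ _ _ mu _ (EFin \o g)
    (measurable_itv `[- B, B])).1 (integrable_segment B cg).
  congr (mu.-integrable _ _); apply/funext => t; rewrite patchE.
  case: ifPn => //=; rewrite notin_setE /= in_itv /= => /negP.
  by rewrite -ler_norml -ltNge => /g0 ->.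
have ab : a < b by rewrite /a /b; lra.
apply: (@lt_le_trans _ _ (Rintegral mu `[a, b] (cst (g c / 2)))).
  rewrite Rintegral_cst // lebesgue_measure_segment //.
  by rewrite mulr_gt0 ?divr_gt0 ?subr_gt0.
apply: (@le_trans _ _ (Rintegral mu `[a, b] g)).
  apply: le_Rintegral => //.
  - apply: continuous_compact_integrable; first exact: segment_compact.
    by apply: continuous_subspaceT => t; exact: cvg_cst.
  - exact: intg.
  - move=> t /=; rewrite in_itv /= => /andP[at_ tb]; apply/ltW/dg.
    by rewrite /a /b in at_ tb; rewrite ltr_norml; apply/andP; split; lra.
rewrite [leLHS]Rintegral_mkcond; apply: le_Rintegral => //.
- have := (@integrable_mkcond _ _ _ mu _ (EFin \o g)
    (measurable_itv `[a, b])).1 (intg _ (measurable_itv _)).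
  by rewrite restrict_EFin.
- exact: intg.
- by move=> t _; rewrite patchE; case: ifP.
Qed.

Lemma Rintegral_derive B g (dg : R -> R) : 0 < B ->
  (forall t : R, is_derive t (1 : R) g (dg t)) -> continuous dg ->
  (forall t, B < `|t| -> g t = 0) -> (forall t, B < `|t| -> dg t = 0) ->
  Int dg = 0.
Proof.
move=> B0 gdg cdg g0 dg0.
have cg : continuous g.
  by move=> t; apply/differentiable_continuous/derivable1_diffP.
(* The vanishing hypotheses are strict inequalities, so the endpoints are moved to [B + 1], where
   [g] is zero. *)
have B1 : B + 1 > B by lra.
have dg0' t : B + 1 < `|t| -> dg t = 0 by move=> /(lt_trans B1); exact: dg0.
rewrite (Rintegral_setT_segment dg0') /Rintegral.
have lt1 : - (B + 1) < B + 1 by lra.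
rewrite (continuous_FTC2 lt1 (continuous_subspaceT cdg) (F := g)) //=.
- rewrite g0; last by rewrite ger0_norm; lra.
  by rewrite g0 ?subrr // normrN ger0_norm; lra.
- split=> [t _| |]; first by have [] := gdg t.
  + exact: cvg_at_right_filter (cg _).
  + exact: cvg_at_left_filter (cg _).
- by move=> t _; rewrite derive1E; have [] := gdg t.
Qed.

End OneDimensional.

(** * The iterated integral of continuous functions supported in a box *)

Section IteratedIntegral.
Variable R : realType.

Lemma continuous_lin (T : topologicalType) (a : R) (g h : T -> R) :
  continuous g -> continuous h -> continuous (fun x => a * g x + h x).
Proof.
by move=> cg ch x; apply: cvgD (ch x); apply: cvgM (cg x); exact: cvg_cst.
Qed.

Lemma cvg_rV (T : Type) (F : set_system T) (N : nat) (f : T -> 'rV[R]_N)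
    (l : 'rV[R]_N) : Filter F ->
  (forall i, f x 0 i @[x --> F] --> l 0 i) -> f x @[x --> F] --> l.
Proof.
move=> FF fl; apply/cvg_ballP => e e0.
have : \forall x \near F, forall i : 'I_N, ball (l 0 i) e (f x 0 i).
  by apply: filter_forall => i; move/cvg_ballP : (fl i); exact.
by apply: filter_app; near=> x => fx; split=> // i j; rewrite ord1.
Unshelve. all: by end_near. Qed.

Lemma continuous_row_cons (N : nat) :
  continuous (fun p : R * 'rV[R]_N => row_mx (p.1%:M : 'rV_1) p.2).
Proof.
move=> [t v]; apply: cvg_rV => i.
have -> : (fun p : R * 'rV[R]_N => row_mx (p.1%:M : 'rV_1) p.2 0 i) =
    fun p => match fintype.split i with inl _ => p.1 | inr j => p.2 0 j end.
  apply/funext => p; rewrite mxE; case: fintype.split => // j.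
  by rewrite !ord1 mxE eqxx mulr1n.
rewrite mxE; case: fintype.split => [j|j].
  rewrite !ord1 mxE eqxx mulr1n; exact: cvg_fst.
apply: (@cvg_comp _ _ _ snd (fun w : 'rV[R]_N => w 0 j)).
  exact: cvg_snd.
exact: coord_continuous.
Qed.

(** A cube rather than an arbitrary compact set: slices are supported in the cube of the same
    half-side, so one constant serves the whole induction on the dimension. *)
Definition box_supported (B : R) (N : nat) (h : 'rV[R]_N -> R) :=
  forall (x : 'rV[R]_N) i, B < `|x 0 i| -> h x = 0.

Definition slice (N : nat) (h : 'rV[R]_N.+1 -> R) (t : R) : 'rV[R]_N -> R :=
  fun v => h (row_mx (t%:M : 'rV_1) v).

Lemma row_cons0 (N : nat) (t : R) (v : 'rV[R]_N) :
  (row_mx (t%:M : 'rV_1) v : 'rV_N.+1) 0 0 = t.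
Proof.
rewrite -[RHS](_ : (t%:M : 'rV_1) 0 0 = _); last by rewrite mxE eqxx mulr1n.
rewrite -(row_mxEl (t%:M : 'rV_1) v); congr (_ _ _); exact/val_inj.
Qed.

Lemma row_consS (N : nat) (t : R) (v : 'rV[R]_N) i :
  (row_mx (t%:M : 'rV_1) v : 'rV_N.+1) 0 (lift ord0 i) = v 0 i.
Proof.
by rewrite -(row_mxEr (t%:M : 'rV_1) v); congr (_ _ _); exact/val_inj.
Qed.

Lemma row_cons_eta (N : nat) (x : 'rV[R]_N.+1) :
  x = row_mx ((x 0 0)%:M : 'rV_1) (@rsubmx R 1 1 N x).
Proof.
apply/rowP => i; case: (unliftP ord0 i) => [j ->|->]; last by rewrite row_cons0.
by rewrite row_consS mxE; congr (x _ _); exact/val_inj.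
Qed.

Lemma slice_box (B : R) (N : nat) (h : 'rV[R]_N.+1 -> R) t :
  box_supported B h -> box_supported B (slice h t).
Proof. by move=> h0 v i vi; apply: (h0 _ (lift ord0 i)); rewrite row_consS. Qed.

Lemma slice_out (B : R) (N : nat) (h : 'rV[R]_N.+1 -> R) t :
  box_supported B h -> B < `|t| -> slice h t = cst 0.
Proof. by move=> h0 Bt; apply/funext => v; apply: (h0 _ 0); rewrite row_cons0. Qed.

Lemma slice_continuous2 (N : nat) (h : 'rV[R]_N.+1 -> R) : continuous h ->
  continuous (fun p : R * 'rV[R]_N => slice h p.1 p.2).
Proof.
by move=> ch p; apply: continuous_comp; [exact: continuous_row_cons | exact: ch].
Qed.

Lemma slice_continuous (N : nat) (h : 'rV[R]_N.+1 -> R) t : continuous h ->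
  continuous (slice h t).
Proof.
move=> ch v.
apply: (@continuous_comp _ (R * 'rV[R]_N)%type _ (fun v => (t, v))
  (fun p => slice h p.1 p.2)); last exact: slice_continuous2.
exact: (cvg_pair (G := nbhs t) (H := nbhs v) (cvg_cst t) cvg_id).
Qed.

(** Uniform in [v]: on the compact cube this is the tube lemma applied to the jointly continuous
    difference of slices, and off the cube both slices vanish. *)
Lemma slice_near (B e : R) (N : nat) (h : 'rV[R]_N.+1 -> R) t :
  continuous h -> box_supported B h -> 0 < e ->
  \forall s \near t, forall v, `|slice h s v - slice h t v| < e.
Proof.
move=> ch h0 e0.
pose K : set 'rV[R]_N := [set v | forall i, `[- B, B]%classic (v ord0 i)].
have cK : compact K.
  by apply: (@rV_compact R N (fun=> `[- B, B]%classic)) => i;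
    exact: segment_compact.
have : \forall s \near t, K `<=` [set v | `|slice h s v - slice h t v| < e].
  apply: ((compact_near_coveringP K).1 cK _ (nbhs t)
    (fun s v => `|slice h s v - slice h t v| < e)) => v Kv.
  have cd : {for (v, t), continuous
      (fun p : 'rV[R]_N * R => slice h p.2 p.1 - slice h t p.1)}.
    apply: cvgB.
      apply: (@continuous_comp _ (R * 'rV[R]_N)%type _
        (fun p : 'rV[R]_N * R => (p.2, p.1)) (fun p => slice h p.1 p.2)).
        exact: (cvg_pair (G := nbhs t) (H := nbhs v) cvg_snd cvg_fst).
      exact: slice_continuous2.
    apply: (@continuous_comp _ 'rV[R]_N _ fst (slice h t)); first exact: cvg_fst.
    exact: slice_continuous.
  move/cvgr_norm_lt : cd => /(_ e); rewrite /= subrr normr0; exact.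
apply: filter_app; near=> s => sK v.
have [vK|] := pselect (K v); first exact: sK.
move=> /existsNP[i /negP]; rewrite /= in_itv /= -ler_norml -ltNge => vi.
by rewrite !(slice_box _ h0 vi) subrr normr0.
Unshelve. all: by end_near. Qed.

Lemma integral_rV0 N : integral_rV (cst 0 : 'rV[R]_N -> R) = 0.
Proof.
elim: N => [//|N IH] /=; rewrite (@eq_Rintegral _ _ _ _ _ (cst 0)) => [|t _].
  by rewrite Rintegral_cst // mul0r.
exact: IH.
Qed.

Lemma integral_rV_slice (N : nat) (h : 'rV[R]_N.+1 -> R) :
  integral_rV h =
  Rintegral (@lebesgue_measure R) setT (fun t => integral_rV (slice h t)).
Proof. by []. Qed.

(** Linearity and the norm bound are named as properties of a dimension because they go through one
    induction: in dimension [N.+1] each requires the inner integral to be continuous, which rests on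
    both of them in dimension [N]. *)
Definition integral_rV_linear_prop (B : R) (N : nat) :=
  forall (a : R) (g h : 'rV[R]_N -> R),
  continuous g -> continuous h -> box_supported B g -> box_supported B h ->
  integral_rV (fun x => a * g x + h x) = a * integral_rV g + integral_rV h.

Definition integral_rV_bound_prop (B : R) (N : nat) :=
  forall (M : R) (h : 'rV[R]_N -> R),
  continuous h -> box_supported B h -> (forall x, `|h x| <= M) ->
  `|integral_rV h| <= (2 * B) ^+ N * M.

Lemma int_slice_continuous_aux (B : R) (N : nat) (h : 'rV[R]_N.+1 -> R) :
  0 < B -> integral_rV_linear_prop B N -> integral_rV_bound_prop B N ->
    continuous h -> box_supported B h ->
  continuous (fun t => integral_rV (slice h t)).
Proof.
move=> B0 IL IB ch h0 t; apply/cvgrPdist_lt => e e0.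
pose c := (2 * B) ^+ N.
have c0 : 0 < c by rewrite exprn_gt0 //; lra.
(* The factor 2 compensates for the non-strict bound on integrals: the final estimate is [e / 2],
   strictly below [e]. *)
have e'0 : 0 < e / (2 * c) by rewrite divr_gt0 // mulr_gt0.
have := slice_near t ch h0 e'0; apply: filter_app; near=> s => sh.
rewrite distrC.
have -> : integral_rV (slice h s) - integral_rV (slice h t) =
    integral_rV (fun v => -1 * slice h t v + slice h s v).
  rewrite IL ?mulN1r 1?addrC //;
    by [exact: slice_continuous | exact: slice_box].
apply: (@le_lt_trans _ _ (c * (e / (2 * c)))); last first.
  rewrite (_ : c * _ = e / 2); first lra.
  by field; rewrite gt_eqF.
apply: IB => [|v i vi|v].
- by apply: continuous_lin; exact: slice_continuous.
- by rewrite !(slice_box _ h0 vi) mulr0 addr0.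
- by rewrite mulN1r addrC; exact/ltW.
Unshelve. all: by end_near. Qed.

Lemma integral_rV_lin_bound (B : R) (N : nat) : 0 < B ->
  integral_rV_linear_prop B N /\ integral_rV_bound_prop B N.
Proof.
move=> B0; elim: N => [|N [IL IB]].
  by split=> [a g h|M h _ _ hM] //=; rewrite expr0 mul1r.
have sup (h : 'rV[R]_N.+1 -> R) t : box_supported B h -> B < `|t| ->
    integral_rV (slice h t) = 0.
  by move=> h0 Bt; rewrite (slice_out h0 Bt) integral_rV0.
split=> [a g h cg ch g0 h0|M h ch h0 hM]; rewrite !integral_rV_slice.
  rewrite -(Rintegral_linear (B := B)); first last.
  - by move=> t; exact: sup.
  - by move=> t; exact: sup.
  - exact: int_slice_continuous_aux IL IB ch h0.
  - exact: int_slice_continuous_aux IL IB cg g0.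
  apply: eq_Rintegral => t _; rewrite -IL //;
    by [exact: slice_continuous | exact: slice_box].
rewrite exprS -mulrA; apply: Rintegral_bound => //.
- exact: int_slice_continuous_aux IL IB ch h0.
- by move=> t; exact: sup.
- by move=> t; apply: IB; [exact: slice_continuous | exact: slice_box | move=> v;
    exact: hM].
Qed.

Lemma integral_rV_linear (B : R) (N : nat) (a : R) (g h : 'rV[R]_N -> R) :
  0 < B -> continuous g -> continuous h ->
  box_supported B g -> box_supported B h ->
  integral_rV (fun x => a * g x + h x) = a * integral_rV g + integral_rV h.
Proof. by move=> B0; have [IL _] := integral_rV_lin_bound N B0; exact: IL. Qed.

Lemma integral_rV_bound (B : R) (N : nat) (M : R) (h : 'rV[R]_N -> R) :
  0 < B -> continuous h -> box_supported B h -> (forall x, `|h x| <= M) ->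
  `|integral_rV h| <= (2 * B) ^+ N * M.
Proof. by move=> B0; have [_ IB] := integral_rV_lin_bound N B0; exact: IB. Qed.

Lemma int_slice_continuous (B : R) (N : nat) (h : 'rV[R]_N.+1 -> R) :
  0 < B -> continuous h -> box_supported B h ->
  continuous (fun t => integral_rV (slice h t)).
Proof.
by move=> B0; have [] := integral_rV_lin_bound N B0;
  exact: int_slice_continuous_aux.
Qed.

Lemma integral_rV_ge0 (N : nat) (h : 'rV[R]_N -> R) :
  (forall x, 0 <= h x) -> 0 <= integral_rV h.
Proof.
elim: N h => [|N IH] h h0 //=; apply: Rintegral_ge0 => t _.
by apply: IH => v; exact: h0.
Qed.

Lemma integral_rV_gt0 (B : R) (N : nat) (h : 'rV[R]_N -> R) x : 0 < B ->
  continuous h -> box_supported B h -> (forall y, 0 <= h y) -> 0 < h x ->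
  0 < integral_rV h.
Proof.
move=> B0; elim: N h x => [|N IH] h x ch hB h0 hx.
  by rewrite /= (_ : 0 = x) //; apply/rowP => -[].
rewrite integral_rV_slice; apply: (Rintegral_gt0 (c := x 0 0) B0).
- exact: int_slice_continuous ch hB.
- by move=> t Bt; rewrite (slice_out hB Bt) integral_rV0.
- by move=> t; apply: integral_rV_ge0 => v; exact: h0.
apply: (IH _ (@rsubmx R 1 1 N x)).
- exact: slice_continuous.
- exact: slice_box.
- by move=> v; exact: h0.
- by rewrite /slice -row_cons_eta.
Qed.

End IteratedIntegral.

(** * Integrals of partial derivatives *)

Section IntegralOfPartial.
Variable R : realType.

Lemma is_derive_cvg (V W : normedModType R) (f : V -> W) (x v : V) (l : W) :
  s^-1 *: (f (s *: v + x) - f x) @[s --> (0 : R)^'] --> l -> is_derive x v f l.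
Proof.
move=> fl; split; first by apply/cvg_ex; exists l.
exact: cvg_lim.
Qed.

(** Brings directional derivatives down to functions of one real variable, where slices are easy to
    compare and the mean value theorem is available. *)
Lemma is_derive_line (V W : normedModType R) (f : V -> W) (x v : V) (l : W) :
  is_derive x v f l <-> is_derive (0 : R) (1 : R) (fun s => f (s *: v + x)) l.
Proof.
have E : (fun s : R => s^-1 *: (f (s *: v + x) - f x)) =
  (fun s : R => s^-1 *: (f ((s *: (1 : R) + 0) *: v + x) - f (0 *: v + x))).
  by apply/funext => s; rewrite addr0 scale0r add0r [s *: 1]mulr1.
split=> [[df <-]|[df <-]]; apply: is_derive_cvg.
  by rewrite -E; exact: df.
by rewrite E; exact: df.
Qed.

(** Covers both orders of [a] and [b], locating the intermediate point only by its distance to [a];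
    increments of either sign are then treated alike. *)
Lemma MVT_dist (k dk : R -> R) (a b : R) :
  (forall u : R, is_derive u (1 : R) k (dk u)) ->
  exists2 c, `|c - a| <= `|b - a| & k b - k a = dk c * (b - a).
Proof.
move=> kdk.
have ck : continuous k.
  by move=> u; apply/differentiable_continuous/derivable1_diffP.
have [ab|/ltW ba] := leP a b.
  have [c + ->] := MVT_segment ab (fun u _ => kdk u) (continuous_subspaceT ck).
  rewrite in_itv /= => /andP[ac cb]; exists c => //.
  by rewrite !ger0_norm ?subr_ge0 // lerB.
have [c + E] := MVT_segment ba (fun u _ => kdk u) (continuous_subspaceT ck).
rewrite in_itv /= => /andP[bc ca]; exists c.
  by rewrite !ler0_norm ?subr_le0 // !opprB lerB.
by rewrite -opprB E -mulrN opprB.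
Qed.

Lemma delta_row_cons0 (N : nat) :
  delta_mx 0 0 = row_mx (1%:M : 'rV[R]_1) 0 :> 'rV[R]_N.+1.
Proof.
apply/rowP => k; case: (unliftP ord0 k) => [j ->|->].
  by rewrite row_consS !mxE.
by rewrite row_cons0 !mxE.
Qed.

Lemma delta_row_consS (N : nat) (j : 'I_N) :
  delta_mx 0 (lift ord0 j) = row_mx (0%:M : 'rV[R]_1) (delta_mx 0 j)
    :> 'rV[R]_N.+1.
Proof.
apply/rowP => k; case: (unliftP ord0 k) => [l ->|->].
  by rewrite row_consS !mxE (inj_eq lift_inj).
by rewrite row_cons0 !mxE.
Qed.

Lemma line_row_cons (N : nat) (s a t : R) (w v : 'rV[R]_N) :
  s *: (row_mx (a%:M : 'rV_1) w : 'rV_N.+1) + row_mx (t%:M : 'rV_1) v =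
  row_mx ((s * a + t)%:M : 'rV_1) (s *: w + v).
Proof.
have E (M : nat) (A C : 'rV[R]_M) k : (s *: A + C) 0 k = s * A 0 k + C 0 k.
  by rewrite !mxE.
apply/rowP => k; rewrite E; case: (unliftP ord0 k) => [j ->|->].
  by rewrite !row_consS E.
by rewrite !row_cons0.
Qed.

(** * Differentiation under the integral sign *)

Section Partial.
Variables (B : R) (N : nat) (h g : 'rV[R]_N.+1 -> R).
Hypotheses (B0 : 0 < B) (ch : continuous h) (cg : continuous g).
Hypotheses (h0 : box_supported B h) (g0 : box_supported B g).

Lemma is_derive_slice (j : 'I_N) t v :
  (forall x, is_derive x (delta_mx 0 (lift ord0 j)) h (g x)) ->
  is_derive v (delta_mx 0 j) (slice h t) (slice g t v).
Proof.
move=> hg; apply/is_derive_line.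
have /is_derive_line := hg (row_mx (t%:M : 'rV_1) v).
congr (is_derive _ _ _ _); apply/funext => s.
by rewrite delta_row_consS line_row_cons mulr0 add0r.
Qed.

Lemma is_derive_slice0 v (t : R) :
  (forall x, is_derive x (delta_mx 0 0) h (g x)) ->
  is_derive t (1 : R) (fun u => slice h u v) (slice g t v).
Proof.
move=> hg; apply/is_derive_line.
have /is_derive_line := hg (row_mx (t%:M : 'rV_1) v).
congr (is_derive _ _ _ _); apply/funext => s.
by rewrite delta_row_cons0 line_row_cons scaler0 add0r.
Qed.

(** For each [v] the mean value theorem turns the difference quotient into [slice g u v] with [u]
    within [|s|] of [t]. By [slice_near] this is uniformly close to [slice g t v], although [u]
    depends on [v], and the norm bound concludes. *)
Lemma is_derive_integral_slice (t : R) :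
  (forall x, is_derive x (delta_mx 0 0) h (g x)) ->
  is_derive t (1 : R) (fun u => integral_rV (slice h u))
    (integral_rV (slice g t)).
Proof.
move=> hg; apply: is_derive_cvg; apply/cvgrPdist_lt => e e0.
pose c := (2 * B) ^+ N.
have c0 : 0 < c by rewrite exprn_gt0 // mulr_gt0.
have e'0 : 0 < e / (2 * c) by rewrite divr_gt0 // mulr_gt0.
have /nbhs_ballP[d /= d0 dg] := slice_near t cg g0 e'0.
near=> s.
have s0 : s != 0 by near: s; exact: nbhs_dnbhs_neq.
have sd : `|s| < d.
  near: s; apply: dnbhs0_lt; exact: d0.
rewrite [s *: 1]mulr1 distrC.
have cs u : continuous (slice h u) by exact: slice_continuous.
have bs u : box_supported B (slice h u) by exact: slice_box.
have cgt : continuous (slice g t) by exact: slice_continuous.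
have bgt : box_supported B (slice g t) by exact: slice_box.
have c0s : continuous (fun _ : 'rV[R]_N => 0 : R) by exact: cst_continuous.
have b0s : box_supported B (fun _ : 'rV[R]_N => 0) by [].
have cB : continuous (fun v => -1 * slice h t v + slice h (s + t) v).
  exact: continuous_lin.
have bB : box_supported B (fun v => -1 * slice h t v + slice h (s + t) v).
  by move=> v i vi; rewrite !(bs _ _ _ vi) !(mulr0, addr0).
(* The trailing [+ 0] gives a scalar multiple the shape [a * g x + h x] expected by the linearity
   lemma. *)
have cD : continuous (fun v => s^-1 *
    (-1 * slice h t v + slice h (s + t) v) + 0).
  exact: continuous_lin.
have bD : box_supported B (fun v => s^-1 *
    (-1 * slice h t v + slice h (s + t) v) + 0).
  by move=> v i vi; rewrite !(bs _ _ _ vi) !(mulr0, addr0).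
have -> : s^-1 *: (integral_rV (slice h (s + t)) - integral_rV (slice h t)) -
    integral_rV (slice g t) =
    integral_rV (fun v => -1 * slice g t v +
      (s^-1 * (-1 * slice h t v + slice h (s + t) v) + 0)).
  rewrite (integral_rV_linear _ B0) //.
  rewrite (integral_rV_linear _ B0) //.
  rewrite (integral_rV_linear _ B0) // integral_rV0 addr0 !mulN1r addrC.
  by rewrite [_ - integral_rV (slice h t)]addrC.
apply: (@le_lt_trans _ _ (c * (e / (2 * c)))); last first.
  rewrite (_ : c * _ = e / 2); first lra.
  by field; rewrite gt_eqF.
apply: (integral_rV_bound B0) => [|v i vi|v].
- by apply: continuous_lin => //; exact: slice_continuous.
- by rewrite !(bs _ _ _ vi) !(slice_box _ g0 vi) !(mulr0, addr0).
have [u ut E] := MVT_dist t (s + t) (fun u => is_derive_slice0 v u hg).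
rewrite addrK in ut E.
rewrite !mulN1r addr0 [_ + slice h _ _]addrC E mulrC mulfK // addrC.
apply/ltW/dg; rewrite /ball /= distrC; exact: le_lt_trans ut sd.
Unshelve. all: by end_near. Qed.

End Partial.

(** For an inner coordinate every slice already integrates to zero by induction. For the outermost
    one, the inner integral of [g] is the derivative of that of [h], and the fundamental theorem of
    calculus applies on the line. *)
Lemma integral_rV_partial (B : R) (N : nat) (h g : 'rV[R]_N -> R) (i : 'I_N) :
  0 < B -> continuous h -> continuous g ->
  box_supported B h -> box_supported B g ->
  (forall x, is_derive x (delta_mx 0 i) h (g x)) -> integral_rV g = 0.
Proof.
move=> B0; elim: N h g i => [|N IH] h g i; first by case: i.
move=> ch cg h0 g0; rewrite integral_rV_slice.
case: (unliftP ord0 i) => [j ->|->] hg.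
  rewrite (@eq_Rintegral _ _ _ _ _ (cst 0)) => [|t _].
    by rewrite Rintegral_cst // mul0r.
  apply: (IH (slice h t) _ j).
  - exact: slice_continuous.
  - exact: slice_continuous.
  - exact: slice_box.
  - exact: slice_box.
  - by move=> v; exact: is_derive_slice.
apply: (Rintegral_derive B0 (g := fun t => integral_rV (slice h t))).
- by move=> t; exact: (is_derive_integral_slice B0 ch cg h0 g0 _ hg).
- exact: int_slice_continuous cg g0.
- by move=> t Bt; rewrite (slice_out h0 Bt) integral_rV0.
- by move=> t Bt; rewrite (slice_out g0 Bt) integral_rV0.
Qed.

End IntegralOfPartial.

(** * Functions flat at the origin *)

Section FlatFunctions.
Variable R : realType.
Implicit Types (p q : {poly R}) (t y : R).

(** For [p = 1] this is the standard smooth function flat at the origin; the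
    whole family is stable under differentiation. *)
Definition flat p t : R := if 0 < t then p.[t^-1] * expR (- t^-1) else 0.

Lemma poly_expR_bounded p : exists C, forall y, 0 <= y ->
  `|p.[y] * expR (- y)| <= C.
Proof.
exists (\sum_(i < size p) `|p`_i| * i`!%:R) => y y0.
rewrite horner_coef mulr_suml; apply: le_trans (ler_norm_sum _ _ _) _.
apply: ler_sum => i _; rewrite -mulrA normrM ler_wpM2l //.
rewrite expRN ger0_norm; last by rewrite mulr_ge0 ?exprn_ge0 ?invr_ge0 ?expR_ge0.
rewrite ler_pdivrMr ?expR_gt0 //.
case: (i : nat) => [|m].
  by rewrite expr0 mul1r -expR0 ler_expR.
have := expR_ge1Dxn m y0.
have f0 : 0 < m.+1`!%:R :> R by rewrite ltr0n fact_gt0.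
move=> H; have : y ^+ m.+1 / m.+1`!%:R <= expR y by lra.
by rewrite ler_pdivrMr // mulrC.
Qed.

(** A bound of order two at 0 makes the difference quotient at 0 tend to 0: this settles
    differentiability at the one point where no formula is available. *)
Lemma flat_quadratic p : exists C, forall t, `|flat p t| <= C * t ^+ 2.
Proof.
(* With [y = t^-1], the extra factor ['X^2] is what produces [t ^+ 2] on the right. *)
have [C HC] := poly_expR_bounded (p * 'X^2).
exists C => t; rewrite /flat; case: ltP => t0; last first.
  rewrite normr0 mulr_ge0 ?sqr_ge0 //.
  exact: le_trans (normr_ge0 _) (HC 0 (lexx _)).
have := HC t^-1; rewrite invr_ge0 ltW // => /(_ isT).
rewrite hornerM hornerXn => H.
have -> : p.[t^-1] * expR (- t^-1) = p.[t^-1] * t^-1 ^+ 2 * expR (- t^-1) * t ^+ 2.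
  by field; rewrite gt_eqF.
by rewrite normrM (ger0_norm (sqr_ge0 t)) ler_wpM2r // sqr_ge0.
Qed.

(** With y = 1/t, the derivative in t of p(y) exp(-y) is y^2 (p(y) - p'(y)) exp(-y). *)
Definition dflat p : {poly R} := 'X^2 * (p - p^`()).

Lemma is_derive_flat p t : is_derive t (1 : R) (flat p) (flat (dflat p) t).
Proof.
have [t0|t0|<-] := ltgtP 0 t.
- rewrite /flat t0.
  have E : \forall s \near t, (fun s : R => p.[s^-1] * expR (- s^-1)) s = flat p s.
    near=> s; rewrite /flat ifT //; near: s; exact: lt_nbhsr.
  apply: (near_eq_is_derive E).
  have tn0 : t != 0 by rewrite gt_eqF.
  have dV : is_derive t (1 : R) (fun s : R => s^-1) (- t^-2).
    apply: is_derive_eq (is_deriveV tn0 (is_derive_id _ _)) _.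
    by rewrite [_ *: 1]mulr1.
  have d1 : is_derive t (1 : R) (fun s : R => p.[s^-1]) (p^`().[t^-1] * - t^-2).
    exact: (is_derive1_comp (f := horner p) (g := fun s : R => s^-1)).
  have d2 : is_derive t (1 : R) (fun s : R => expR (- s^-1)) (expR (- t^-1) * t^-2).
    apply: (is_derive1_comp (f := expR) (g := fun s : R => - s^-1)).
    by apply: is_derive_eq (is_deriveN dV) _; rewrite opprK.
  apply: is_derive_eq (is_deriveM d1 d2) _.
  rewrite /dflat hornerM hornerXn hornerD hornerN !/(_ *: _) /= -exprVn.
  by ring.
- have E : \forall s \near t, (cst 0 : R -> R) s = flat p s.
    near=> s; rewrite /flat ifF //; apply/negbTE; rewrite -leNgt ltW //.
    near: s; exact: lt_nbhsl.
  apply: (near_eq_is_derive E).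
  by rewrite /flat ltNge ltW //=; exact: is_derive_cst.
rewrite {2}/flat ltxx; apply: is_derive_cvg.
have [C HC] := flat_quadratic p.
have C0 : 0 <= C by have := HC 1; rewrite expr1n mulr1; exact: le_trans.
apply/cvgrPdist_lt => e e0; near=> s.
have s0 : s != 0 by near: s; exact: nbhs_dnbhs_neq.
have sd : `|s| < e / (C + 1).
  by near: s; apply: dnbhs0_lt; rewrite divr_gt0 //; lra.
rewrite addr0 [s *: 1]mulr1 {2}/flat ltxx subr0 sub0r normrN normrM normfV.
have ns0 : 0 < `|s| by rewrite normr_gt0.
rewrite mulrC ltr_pdivrMr //; apply: le_lt_trans (HC s) _.
rewrite -real_normK ?num_real // expr2 mulrA ltr_pM2r //.
rewrite ltr_pdivlMr in sd; last lra.
nra.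
Unshelve. all: by end_near. Qed.

Lemma flat1_ge0 t : 0 <= flat 1 t.
Proof. by rewrite /flat; case: ifP => // _; rewrite hornerC mul1r expR_ge0. Qed.

Lemma flat1_gt0 t : 0 < t -> 0 < flat 1 t.
Proof. by move=> t0; rewrite /flat t0 hornerC mul1r expR_gt0. Qed.

Lemma flat_le0 p t : t <= 0 -> flat p t = 0.
Proof. by move=> t0; rewrite /flat ltNge t0. Qed.

End FlatFunctions.

(** * Smooth bump functions *)

Section SmoothFunctions.
Variable R : realType.
Variable N : nat.
Implicit Types (f g h : 'rV[R]_N -> R).
Local Notation smooth := (@smooth_on R N setT).

Lemma partials_rcons (s : seq 'I_N) i h :
  partials (rcons s i) h = partials s (partial i h).
Proof. by rewrite /partials foldr_rcons. Qed.

(** Smoothness is obtained by exhibiting a class of differentiable functions stable under partial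
    derivatives. The list is peeled from its end, since the last index is the derivative taken first
    and leaves a function of the class. *)
Lemma smooth_class (P : ('rV[R]_N -> R) -> Prop) :
  (forall h, P h -> forall x, differentiable h x) ->
  (forall h i, P h -> P (partial i h)) ->
  forall h, P h -> smooth h.
Proof.
move=> Pd Pp h Ph s x _.
elim/last_ind: s h Ph => [|s i IH] h Ph; first exact: Pd.
by rewrite partials_rcons; apply: IH; exact: Pp.
Qed.

Lemma smooth_differentiable (U : set 'rV[R]_N) h x :
  smooth_on U h -> U x -> differentiable h x.
Proof. by move=> hs; exact: (hs [::]). Qed.

Lemma smooth_partial (U : set 'rV[R]_N) h i : smooth_on U h ->
  smooth_on U (partial i h).
Proof. by move=> hs s x Ux; rewrite -partials_rcons; exact: hs. Qed.

Lemma partialD f g i : (forall x, differentiable f x) ->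
  (forall x, differentiable g x) ->
  partial i (fun x => f x + g x) = fun x => partial i f x + partial i g x.
Proof.
move=> df dg; apply/funext => x; rewrite /partial.
by apply: deriveD; exact: diff_derivable.
Qed.

Lemma partialM f g i : (forall x, differentiable f x) ->
  (forall x, differentiable g x) ->
  partial i (fun x => f x * g x) = fun x =>
    partial i f x * g x + f x * partial i g x.
Proof.
move=> df dg; apply/funext => x; rewrite /partial.
apply: etrans (deriveM (diff_derivable (df x)) (diff_derivable (dg x))) _.
by rewrite addrC [_ *: _]mulrC.
Qed.

(** By the Leibniz rule, finite sums of products of two smooth functions are
    stable under differentiation. *)
Lemma smoothM f g : smooth f -> smooth g -> smooth (fun x => f x * g x).
Proof.
move=> fs gs.
pose sum_of_products (l : seq (('rV[R]_N -> R) * ('rV[R]_N -> R))) :=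
  fun x => \sum_(u <- l) u.1 x * u.2 x.
pose P h := exists2 l, (forall u, List.In u l ->
  smooth u.1 /\ smooth u.2) & h = sum_of_products l.
have diffP h : smooth h -> forall x, differentiable h x.
  by move=> hs x; exact: smooth_differentiable hs _.
have sump_cons u l : sum_of_products (u :: l) = fun x =>
  u.1 x * u.2 x + sum_of_products l x.
  by apply/funext => x; rewrite /sum_of_products big_cons.
have Pd h : P h -> forall x, differentiable h x.
  move=> [l ls ->] x; elim: l ls => [|u l IH] ls.
    rewrite (_ : sum_of_products [::] = cst 0); first exact: differentiable_cst.
    by apply/funext => y; rewrite /sum_of_products big_nil.
  rewrite sump_cons; have [u1 u2] := ls u (or_introl erefl).
  apply: differentiableD; last by apply: IH => v vl; apply: ls; right.
  by apply: differentiableM; exact: diffP.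
apply: (smooth_class (P := P) Pd); last first.
  exists [:: (f, g)]; first by move=> u [<-|[]].
  by apply/funext => x; rewrite /sum_of_products big_seq1.
move=> _ i [l ls ->]; elim: l ls => [|u l IH] ls.
  exists [::] => //; apply/funext => x.
  rewrite /partial (_ : sum_of_products [::] = cst 0) ?derive_cst //.
  by apply/funext => y; rewrite /sum_of_products big_nil.
have [u1 u2] := ls u (or_introl erefl).
have ls' v : List.In v l -> smooth v.1 /\ smooth v.2.
  by move=> vl; apply: ls; right.
have [l' l's E] := IH ls'.
exists [:: (partial i u.1, u.2), (u.1, partial i u.2) & l'].
  by move=> v [<-|[<-|/l's //]] /=; split=> //; exact: smooth_partial.
rewrite !sump_cons partialD; last 2 first.
- by move=> x; apply: differentiableM; exact: diffP.
- by apply: Pd; exists l.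
rewrite E partialM; [|exact: diffP|exact: diffP].
by apply/funext => x; rewrite addrA.
Qed.

Lemma smooth_cst (c : R) : smooth (fun=> c).
Proof.
apply: (smooth_class (P := fun h => exists c, h = fun=> c)); last by exists c.
  by move=> _ [a ->] x; exact: differentiable_cst.
by move=> _ i [a ->]; exists 0; apply/funext => x; rewrite /partial derive_cst.
Qed.

Lemma smooth_prod (I : finType) (F : I -> 'rV[R]_N -> R) :
  (forall i, smooth (F i)) -> smooth (fun x => \prod_i F i x).
Proof.
move=> Fs; rewrite -fct_prodE.
elim/big_ind: _ => //; [exact: smooth_cst | by move=> f g; exact: smoothM].
Qed.

Lemma is_derive_affine (a b t : R) :
  is_derive t (1 : R) (fun s : R => s * a + b) a.
Proof.
apply: is_derive_eq (is_deriveD (is_deriveM (is_derive_id t (1 : R))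
  (is_derive_cst a t (1 : R))) (is_derive_cst b t (1 : R))) _.
by rewrite !/(_ *: _) /= mulr0 add0r addr0 mulr1.
Qed.

Lemma is_derive_coord (x : 'rV[R]_N) (i j : 'I_N) :
  is_derive x (delta_mx 0 j) (fun y : 'rV[R]_N => y 0 i) ((i == j)%:R : R).
Proof.
apply/is_derive_line.
have -> : (fun s : R => (s *: delta_mx 0 j + x) 0 i) =
    (fun s : R => s * (i == j)%:R + x 0 i).
  by apply/funext => s; rewrite !mxE eqxx.
exact: is_derive_affine.
Qed.

Lemma smooth_flat_affine (p : {poly R}) (sg c : R) (i : 'I_N) :
  smooth (fun x => flat p (sg * x 0 i + c)).
Proof.
pose P h := exists q : {poly R}, h = fun x : 'rV[R]_N => flat q (sg * x 0 i + c).
apply: (smooth_class (P := P)); last by exists p.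
  move=> _ [q ->] x.
  apply: (@differentiable_comp _ _ _ _ (fun y : 'rV[R]_N =>
    sg * y 0 i + c) (flat q)).
    apply: (@differentiable_comp _ _ _ _ (fun y : 'rV[R]_N => y 0 i)
      (fun t : R => sg * t + c)); first exact: differentiable_coord.
    apply/derivable1_diffP.
    have -> : (fun t : R => sg * t + c) = (fun t => t * sg + c).
      by apply/funext => t; rewrite mulrC.
    by have [] := is_derive_affine sg c (x 0 i).
  by apply/derivable1_diffP; have [] := is_derive_flat q (sg * x 0 i + c).
move=> _ j [q ->]; exists ((sg * (i == j)%:R) *: dflat q); apply/funext => x.
have dq : is_derive x (delta_mx 0 j : 'rV[R]_N) (fun x : 'rV[R]_N =>
  flat q (sg * x 0 i + c))
    (flat (dflat q) (sg * x 0 i + c) * (sg * (i == j)%:R)).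
  apply/is_derive_line.
  have -> : (fun s : R => flat q (sg * (s *: delta_mx 0 j + x) 0 i + c)) =
      flat q \o (fun s : R => s * (sg * (i == j)%:R) + (sg * x 0 i + c)).
    by apply/funext => s; rewrite !mxE eqxx /=; congr (flat _ _); ring.
  apply: is_derive1_comp; last exact: is_derive_affine.
  by rewrite mul0r add0r; exact: is_derive_flat.
rewrite /partial; have [_ ->] := dq.
by rewrite /flat; case: ifP => _; rewrite ?mul0r // hornerZ; ring.
Qed.

(** For each coordinate, two one-sided flat functions glued into a factor positive exactly when
    [|x 0 i - a 0 i| < r]; the product is positive exactly on an open cube. The coefficients 1 and
    -1 are explicit to fit [smooth_flat_affine]. *)
Definition bump (a : 'rV[R]_N) (r : R) (x : 'rV[R]_N) : R :=
  \prod_i (flat 1 (1 * x 0 i + (r - a 0 i)) * flat 1 (-1 * x 0 i + (r + a 0 i))).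

Lemma smooth_bump a r : smooth (bump a r).
Proof. by apply: smooth_prod => i; apply: smoothM; exact: smooth_flat_affine. Qed.

Lemma bump_ge0 a r x : 0 <= bump a r x.
Proof. by apply: prodr_ge0 => i _; apply: mulr_ge0; exact: flat1_ge0. Qed.

Lemma bump_gt0 a r : 0 < r -> 0 < bump a r a.
Proof.
move=> r0; apply: prodr_gt0 => i _; apply: mulr_gt0; apply: flat1_gt0; lra.
Qed.

Lemma bump_out (a : 'rV[R]_N) r (x : 'rV[R]_N) i : r < `|x 0 i - a 0 i| ->
  bump a r x = 0.
Proof.
move=> rx; apply/eqP; rewrite prodf_seq_eq0; apply/hasP; exists i.
  by rewrite mem_index_enum.
rewrite /= mulf_eq0; have [xa|xa] := leP 0 (x 0 i - a 0 i).
  by rewrite ger0_norm // in rx; rewrite [X in _ || (X == 0)]flat_le0 ?eqxx ?orbT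
    //; lra.
by rewrite ltr0_norm // in rx; rewrite flat_le0 ?eqxx //; lra.
Qed.

Lemma test_function_bump (U : set 'rV[R]_N) a : open U -> U a ->
  exists2 r, 0 < r & test_function U (bump a r).
Proof.
move=> oU Ua; have := open_nbhs_nbhs (conj oU Ua).
move=> /nbhs_ballP[e /= e0 eU].
(* Balls for the sup norm are open cubes, so the closed cube of half-side [e / 2] lies inside the
   ball of radius [e]. *)
exists (e / 2); first by rewrite divr_gt0.
split; first exact: smooth_bump.
exists [set x : 'rV[R]_N | forall i, `[a 0 i - e / 2,
  a 0 i + e / 2]%classic (x ord0 i)].
split.
- apply: (@rV_compact R N (fun i => `[a 0 i - e / 2, a 0 i + e / 2]%classic)) => i.
  exact: segment_compact.
- move=> x Kx; apply: eU; split=> // i j; rewrite !ord1.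
  have := Kx j; rewrite /= in_itv /= /ball /= => /andP[x1 x2].
  by rewrite ltr_norml; apply/andP; split; lra.
- move=> x /existsNP[i /negP]; rewrite /= in_itv /= => Kx.
  apply: (@bump_out _ _ _ i); rewrite ltNge; apply/negP;
    rewrite ler_norml => /andP[x1 x2].
  by move/negP: Kx; apply; apply/andP; split; lra.
Qed.

End SmoothFunctions.

(** * Integration by parts and the fundamental lemma *)

Section FundamentalLemma.
Variables (R : realType) (N : nat).
Implicit Types (U K : set 'rV[R]_N) (g h phi : 'rV[R]_N -> R).

Definition cont_csupp h := continuous h /\ exists2 B, 0 < B & box_supported B h.

Lemma box_supported_le (B B' : R) h : B <= B' ->
  box_supported B h -> box_supported B' h.
Proof. by move=> BB' h0 x i xi; apply: (h0 x i); exact: le_lt_trans xi. Qed.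

Lemma cont_csupp_common g h : cont_csupp g -> cont_csupp h ->
  exists B, [/\ 0 < B, box_supported B g & box_supported B h].
Proof.
move=> [_ [B1 B10 g0]] [_ [B2 B20 h0]]; exists (Num.max B1 B2); split.
- by rewrite lt_max B10.
- by apply: box_supported_le g0; rewrite le_max lexx.
- by apply: box_supported_le h0; rewrite le_max lexx orbT.
Qed.

Lemma cont_csupp_linear (a : R) g h : cont_csupp g -> cont_csupp h ->
  cont_csupp (fun x => a * g x + h x).
Proof.
move=> cg ch; have [B [B0 g0 h0]] := cont_csupp_common cg ch.
split; first by apply: continuous_lin; [exact: cg.1 | exact: ch.1].
by exists B => // x i xi; rewrite (g0 _ _ xi) (h0 _ _ xi) mulr0 addr0.
Qed.

Lemma cont_csupp0 : cont_csupp (fun=> 0).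
Proof. by split; [exact: cst_continuous | exists 1]. Qed.

Lemma integral_csupp_linear (a : R) g h : cont_csupp g -> cont_csupp h ->
  integral_rV (fun x => a * g x + h x) = a * integral_rV g + integral_rV h.
Proof.
move=> cg ch; have [B [B0 g0 h0]] := cont_csupp_common cg ch.
by apply: (integral_rV_linear _ B0) => //; [exact: cg.1 | exact: ch.1].
Qed.

Lemma integral_csuppD g h : cont_csupp g -> cont_csupp h ->
  integral_rV (fun x => g x + h x) = integral_rV g + integral_rV h.
Proof.
move=> cg ch; have := integral_csupp_linear 1 cg ch.
rewrite mul1r => <-; congr integral_rV.
by apply/funext => x; rewrite mul1r.
Qed.

Lemma compact_box K : compact K ->
  exists2 B : R, 0 < B & forall x, K x -> forall i, `|x 0 i| <= B.
Proof.
move=> /compact_bounded[M [_ HM]]; exists (`|M| + 1); first by rewrite ltr_pwDr.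
move=> x Kx i; apply: (@le_trans _ _ `|x|); last first.
  by apply: HM => //; rewrite (le_lt_trans (ler_norm M)) // ltrDl.
rewrite [leRHS]mx_normrE.
exact: (le_bigmax _ (fun ij => `|x ij.1 ij.2|) (0, i)).
Qed.

Lemma vanishes_near K phi x : compact K -> vanishes_off K phi -> ~ K x ->
  \forall y \near x, phi y = 0.
Proof.
move=> cK p0 nKx.
have oK : open (~` K) by apply: closed_openC; exact: compact_closed.
have := open_nbhs_nbhs (conj oK nKx).
by apply: filter_app; near=> y => /p0.
Unshelve. all: by end_near. Qed.

(** Although [g] is controlled on [U] alone, the product is continuous everywhere: at points of [K]
    both factors are, and near a point off the closed set [K] the product is identically zero. *)
Lemma cont_csupp_mul U K g phi : open U -> compact K -> K `<=` U ->
  (forall x, U x -> {for x, continuous g}) -> continuous phi ->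
  vanishes_off K phi -> cont_csupp (fun x => g x * phi x).
Proof.
move=> oU cK KU cg cp p0; split.
  move=> x; rewrite /prop_for /continuous_at; have [Kx|nKx] := pselect (K x).
    exact: (continuousM (cg x (KU x Kx)) (cp x)).
  have E : \forall y \near x, cst 0 y = g y * phi y.
    have := vanishes_near cK p0 nKx; apply: filter_app.
    by near=> y => ->; rewrite mulr0.
  have -> : (fun x => g x * phi x) x = cst 0 x by rewrite /= p0 // mulr0.
  by apply: cvg_trans (near_eq_cvg E) _; exact: cvg_cst.
have [B B0 KB] := compact_box cK; exists B => // x i xi.
rewrite p0 ?mulr0 // => /KB /(_ i); rewrite leNgt xi //.
Unshelve. all: by end_near. Qed.

Lemma vanishes_partial K phi i : compact K -> vanishes_off K phi ->
  vanishes_off K (partial i phi).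
Proof.
move=> cK p0 x nKx; rewrite /partial.
rewrite -[RHS](derive_cst (0 : R) x (delta_mx 0 i)).
by apply: near_eq_derive; exact: vanishes_near cK p0 nKx.
Qed.

(** The product [g * phi], extended by zero, has a continuous partial derivative on the whole space,
    whose integral vanishes; the Leibniz rule splits it into the two sides. *)
Lemma integration_by_parts_rV U K g phi i : open U -> compact K -> K `<=` U ->
  (forall x, U x -> differentiable g x) ->
  (forall x, U x -> {for x, continuous (partial i g)}) ->
  (forall x, differentiable phi x) -> continuous (partial i phi) ->
  vanishes_off K phi ->
  integral_rV (fun x => partial i g x * phi x) =
  - integral_rV (fun x => g x * partial i phi x).
Proof.
move=> oU cK KU dg cdg dphi cdphi p0.
have cphi : continuous phi by move=> x; exact: differentiable_continuous.
have cg x : U x -> {for x, continuous g}.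
  by move=> Ux; apply: differentiable_continuous; exact: dg.
have dp0 := vanishes_partial i cK p0.
have c1 : cont_csupp (fun x => partial i g x * phi x) by exact: cont_csupp_mul cdg
  cphi p0.
have c2 : cont_csupp (fun x => g x * partial i phi x) by exact: cont_csupp_mul cg
  cdphi dp0.
have c3 : cont_csupp (fun x => g x * phi x) by exact: cont_csupp_mul cg cphi p0.
apply/eqP; rewrite -addr_eq0 -integral_csuppD //; apply/eqP.
have [B [B0 b1 b3]] := cont_csupp_common (cont_csupp_linear 1 c1 c2) c3.
apply: (@integral_rV_partial _ B _ (fun x => g x * phi x) _ i) => //.
- exact: c3.1.
- have -> : (fun x => partial i g x * phi x + g x * partial i phi x) =
    (fun x => 1 * (partial i g x * phi x) + g x * partial i phi x).
    by apply/funext => x; rewrite mul1r.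
  by apply: continuous_lin; [exact: c1.1 | exact: c2.1].
- by move=> x j xj; have := b1 _ _ xj; rewrite mul1r.
move=> x; have [Kx|nKx] := pselect (K x).
  have dgx := derivableP (diff_derivable (v := delta_mx 0 i) (dg _ (KU _ Kx))).
  have dpx := derivableP (diff_derivable (v := delta_mx 0 i) (dphi x)).
  apply: is_derive_eq (is_deriveM dgx dpx) _.
  by rewrite addrC /partial [_ *: _]mulrC.
rewrite p0 // dp0 // !mulr0 addr0.
apply: (near_eq_is_derive (f := cst 0)).
have := vanishes_near cK p0 nKx; apply: filter_app.
by near=> y => ->; rewrite mulr0.
Unshelve. all: by end_near. Qed.

Lemma smooth_continuous_partials (U : set 'rV[R]_N) h (s : seq 'I_N) x :
  smooth_on U h -> U x -> {for x, continuous (partials s h)}.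
Proof. by move=> hs Ux; apply: differentiable_continuous; exact: hs. Qed.

(** If [g a] were nonzero, a bump supported where [g a * g x > 0] would give a nonzero integral.
    Multiplying by the constant [g a] handles both signs at once. *)
Lemma fundamental_lemma U g : open U ->
  (forall x, U x -> {for x, continuous g}) ->
  (forall phi, test_function U phi -> integral_rV (fun x => g x * phi x) = 0) ->
  forall x, U x -> g x = 0.
Proof.
move=> oU cg gphi a Ua; apply/eqP/negPn/negP => ga.
have ga2 : 0 < g a * g a by rewrite -expr2 exprn_even_gt0.
have nW : \forall x \near a, U x /\ 0 < g a * g x.
  apply: filterI; first exact: open_nbhs_nbhs.
  have cga : {for a, continuous (fun x => g a * g x)}.
    exact: (continuousM (@cst_continuous _ _ (g a) a) (cg _ Ua)).
  exact: (cvgr_gt (g a * g a) cga).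
pose W := [set x | U x /\ 0 < g a * g x]°.
have Wa : W a by exact: nW.
have [r r0 [sr [K [cK KW bK]]]] := test_function_bump (@open_interior _ _) Wa.
have WU : W `<=` [set x | U x /\ 0 < g a * g x] by exact: interior_subset.
have KU : K `<=` U by move=> x /KW/WU[].
have tU : test_function U (bump a r) by split=> //; exists K.
have cb : continuous (bump a r).
  by move=> x; exact: (@smooth_continuous_partials setT (bump a r) [::] x sr).
have cgb : cont_csupp (fun x => g x * bump a r x) by exact: cont_csupp_mul oU cK KU
  cg cb bK.
have cagb : cont_csupp (fun x => g a * (g x * bump a r x) + 0) by exact:
  cont_csupp_linear cgb cont_csupp0.
have := gphi _ tU => I0.
have : 0 < integral_rV (fun x => g a * (g x * bump a r x) + 0).
  have [ccontinuous_on [B B0 Bb]] := cagb.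
  apply: (integral_rV_gt0 (x := a) B0) => //.
    move=> y; rewrite addr0 mulrA; have [Ky|nKy] := pselect (K y).
      by rewrite mulr_ge0 ?bump_ge0 //; have [_ /ltW] := WU _ (KW _ Ky).
    by rewrite bK // mulr0.
  by rewrite addr0 mulrA mulr_gt0 // bump_gt0.
by rewrite integral_csupp_linear ?I0 ?integral_rV0 ?mulr0 ?addr0 ?ltxx //;
  exact: cont_csupp0.
Qed.

End FundamentalLemma.

(** * Distributions given by complex functions *)

Section ComplexDistributions.
Variables (R : realType) (N : nat).
Implicit Types (U K : set 'rV[R]_N) (g h : 'rV[R]_N -> R[i]) (phi : 'rV[R]_N -> R).
Local Notation Re := complex.Re.
Local Notation Im := complex.Im.
Local Notation fd := function_distribution.

Definition ccontinuous_on U g := forall x, U x ->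
  {for x, continuous (fun y => Re (g y))} /\ {for x, continuous (fun y =>
    Im (g y))}.

Definition cpartial (i : 'I_N) g : 'rV[R]_N -> R[i] := fun x =>
  (partial i (fun y => Re (g y)) x +i* partial i (fun y => Im (g y)) x)%C.

Definition cC1_on U g := [/\ forall x, U x -> differentiable (fun y => Re (g y)) x,
  forall x, U x -> differentiable (fun y => Im (g y)) x &
  forall i, ccontinuous_on U (cpartial i g)].

Lemma csmooth_cC1 U g : csmooth_on U g -> cC1_on U g.
Proof.
move=> [gr gi]; split=> [x Ux|x Ux|i x Ux].
- exact: smooth_differentiable gr Ux.
- exact: smooth_differentiable gi Ux.
- by split; [exact (smooth_continuous_partials (s := [:: i]) gr Ux)
            |exact (smooth_continuous_partials (s := [:: i]) gi Ux)].
Qed.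

Lemma cC1_ccontinuous U g : cC1_on U g -> ccontinuous_on U g.
Proof.
move=> [gr gi _] x Ux; split; apply: differentiable_continuous;
  [exact: gr | exact: gi].
Qed.

Lemma ccontinuous_on_cst U (a : R[i]) : ccontinuous_on U (fun=> a).
Proof. by move=> x _; split; exact: cst_continuous. Qed.

Lemma ccontinuous_on_lin U (a : R[i]) g h : ccontinuous_on U g ->
  ccontinuous_on U h ->
  ccontinuous_on U (fun x => a * g x + h x).
Proof.
move=> cg ch x Ux; have [gr gi] := cg x Ux; have [hr hi] := ch x Ux.
case: a => ar ai; split.
  have -> : (fun y => Re ((ar +i* ai)%C * g y + h y)) = (fun y =>
      ar * Re (g y) + (- ai * Im (g y) + Re (h y))).
    by apply/funext => y; case: (g y) => ? ?; case: (h y) => ? ? /=; ring.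
  apply: (continuousD (continuousM (@cst_continuous _ _ ar x) gr)).
  exact: (continuousD (continuousM (@cst_continuous _ _ (- ai) x) gi) hr).
have -> : (fun y => Im ((ar +i* ai)%C * g y + h y)) = (fun y =>
    ar * Im (g y) + (ai * Re (g y) + Im (h y))).
  by apply/funext => y; case: (g y) => ? ?; case: (h y) => ? ? /=; ring.
apply: (continuousD (continuousM (@cst_continuous _ _ ar x) gi)).
exact: (continuousD (continuousM (@cst_continuous _ _ ai x) gr) hi).
Qed.

Lemma ccontinuous_on_real_mul U (a : 'rV[R]_N -> R) g : continuous a ->
  ccontinuous_on U g ->
  ccontinuous_on U (fun x => (a x)%:C%C * g x).
Proof.
move=> ca cg x Ux; have [gr gi] := cg x Ux; split.
  have -> : (fun y => Re ((a y)%:C%C * g y)) = (fun y => a y * Re (g y)).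
    by apply/funext => y; case: (g y) => ? ? /=; rewrite mul0r subr0.
  exact: (continuousM (ca x) gr).
have -> : (fun y => Im ((a y)%:C%C * g y)) = (fun y => a y * Im (g y)).
  by apply/funext => y; case: (g y) => ? ? /=; rewrite mul0r addr0.
exact: (continuousM (ca x) gi).
Qed.

Lemma ccontinuous_on_sum U (I : Type) (r : seq I) (G : I -> 'rV[R]_N -> R[i]) :
  (forall i, ccontinuous_on U (G i)) -> ccontinuous_on U (fun x =>
    \sum_(i <- r) G i x).
Proof.
move=> cG; elim: r => [|i r IH].
  by under [X in ccontinuous_on _ X]eq_fun do rewrite big_nil;
    exact: ccontinuous_on_cst.
under [X in ccontinuous_on _ X]eq_fun do rewrite big_cons -[G i _]mul1r.
exact: ccontinuous_on_lin.
Qed.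

(** * Pairing with a fixed test function *)

Section Test.
Variables (U : set 'rV[R]_N) (phi : 'rV[R]_N -> R).
Hypotheses (oU : open U) (tphi : test_function U phi).

Lemma test_continuous : continuous phi.
Proof. by move=> x; exact: (@smooth_continuous_partials _ _ setT phi [::] x
  tphi.1). Qed.

Lemma cont_csupp_test_mul (g : 'rV[R]_N -> R) : (forall x, U x ->
  {for x, continuous g}) ->
  cont_csupp (fun x => g x * phi x).
Proof.
by have [_ [K [cK KU p0]]] := tphi; move=> cg;
  apply: cont_csupp_mul cg test_continuous p0.
Qed.

Lemma function_distribution_lin (a : R[i]) g h : ccontinuous_on U g ->
  ccontinuous_on U h ->
  fd (fun x => a * g x + h x) phi = a * fd g phi + fd h phi.
Proof.
move=> cg ch.
have cgr := cont_csupp_test_mul (fun x Ux => (cg x Ux).1).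
have cgi := cont_csupp_test_mul (fun x Ux => (cg x Ux).2).
have chr := cont_csupp_test_mul (fun x Ux => (ch x Ux).1).
have chi := cont_csupp_test_mul (fun x Ux => (ch x Ux).2).
case: a => ar ai; rewrite /fd.
have -> : (fun x => Re ((ar +i* ai)%C * g x + h x) * phi x) = (fun x =>
    ar * (Re (g x) * phi x) + (- ai * (Im (g x) * phi x) + Re (h x) * phi x)).
  by apply/funext => y; case: (g y) => ? ?; case: (h y) => ? ? /=; ring.
have -> : (fun x => Im ((ar +i* ai)%C * g x + h x) * phi x) = (fun x =>
    ar * (Im (g x) * phi x) + (ai * (Re (g x) * phi x) + Im (h x) * phi x)).
  by apply/funext => y; case: (g y) => ? ?; case: (h y) => ? ? /=; ring.
rewrite (integral_csupp_linear ar cgr (cont_csupp_linear _ cgi chr)).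
rewrite (integral_csupp_linear ar cgi (cont_csupp_linear _ cgr chi)).
rewrite (integral_csupp_linear _ cgi chr) (integral_csupp_linear _ cgr chi).
by apply/eqP; rewrite eq_complex /=; apply/andP; split; apply/eqP; ring.
Qed.

Lemma function_distribution0 : fd (fun _ : 'rV[R]_N => 0) phi = 0.
Proof.
have := function_distribution_lin (-1) (@ccontinuous_on_cst U 0)
  (@ccontinuous_on_cst U 0).
set z := fd (fun _ => 0) phi => H; have -> : z = -1 * z + z;
  last by rewrite mulN1r addNr.
rewrite -{}H; congr (fd _ _).
by apply/funext => x; rewrite mulr0 addr0.
Qed.

Lemma function_distribution_sum (I : Type) (r : seq I) (G : I -> 'rV[R]_N -> R[i]) :
  (forall i, ccontinuous_on U (G i)) ->
  fd (fun x => \sum_(i <- r) G i x) phi = \sum_(i <- r) fd (G i) phi.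
Proof.
move=> cG; elim: r => [|i r IH].
  rewrite big_nil -[RHS]function_distribution0; congr (fd _ _); apply/funext => x;
    exact: big_nil.
rewrite big_cons -IH -[X in _ = X + _]mul1r -function_distribution_lin //;
  last exact: ccontinuous_on_sum.
by congr (fd _ _); apply/funext => x; rewrite big_cons mul1r.
Qed.

Lemma dpartial_function_distribution i g : cC1_on U g ->
  dpartial i (fd g) phi = fd (cpartial i g) phi.
Proof.
move=> [gr gi gp]; have [sphi [K [cK KU p0]]] := tphi.
have dphi x : differentiable phi x by exact: smooth_differentiable sphi I.
have cpphi : continuous (partial i phi).
  by move=> x; exact: (@smooth_continuous_partials _ _ setT phi [:: i] x sphi).
rewrite /dpartial /fd /cpartial /=.
rewrite (integration_by_parts_rV oU cK KU gr (fun x Ux => (gp i x Ux).1) dphi) //.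
rewrite (integration_by_parts_rV oU cK KU gi (fun x Ux => (gp i x Ux).2) dphi) //.
Qed.

End Test.

Lemma function_distribution_eq0 U g : open U -> ccontinuous_on U g ->
  (forall phi, test_function U phi -> fd g phi = 0) -> forall x, U x -> g x = 0.
Proof.
move=> oU cg g0 x Ux; apply/eqP; rewrite eq_complex /=; apply/andP; split;
  apply/eqP.
  apply: (fundamental_lemma oU (fun x Ux => (cg x Ux).1)) Ux => phi /g0.
  by move/eqP; rewrite eq_complex => /andP[/eqP].
apply: (fundamental_lemma oU (fun x Ux => (cg x Ux).2)) Ux => phi /g0.
by move/eqP; rewrite eq_complex => /andP[_ /eqP].
Qed.

Lemma normc_le (a b : R) : `|(a +i* b)%C| <= (`|a| + `|b|)%:C%C.
Proof.
rewrite normc_def lecR.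
rewrite -[leRHS]ger0_norm ?addr_ge0 // -sqrtr_sqr ler_wsqrtr //=.
by rewrite sqrrD !real_normK ?num_real // addrAC lerDl mulrn_wge0 // mulr_ge0.
Qed.

Lemma compact_norm_bound K U (g : 'rV[R]_N -> R) : compact K -> K `<=` U ->
  (forall x, U x -> {for x, continuous g}) ->
  exists2 M : R, 0 <= M & forall x, K x -> `|g x| <= M.
Proof.
move=> cK KU cg.
have cgK : {within K, continuous g}.
  by apply: continuous_in_subspaceT => x; rewrite inE => /KU; exact: cg.
have /compact_bounded[M [_ HM]] := continuous_compact cgK cK.
exists (`|M| + 1) => // x Kx; apply: (HM (`|M| + 1)); last by exists x.
by rewrite (le_lt_trans (ler_norm M)) // ltrDl.
Qed.

Lemma is_distribution_function_distribution U g : open U ->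
  ccontinuous_on U g -> is_distribution U (fd g).
Proof.
move=> oU cg; split=> [a phi psi tphi tpsi|K cK KU].
  have cpr := cont_csupp_test_mul oU tphi (fun x Ux => (cg x Ux).1).
  have cpi := cont_csupp_test_mul oU tphi (fun x Ux => (cg x Ux).2).
  have csr := cont_csupp_test_mul oU tpsi (fun x Ux => (cg x Ux).1).
  have csi := cont_csupp_test_mul oU tpsi (fun x Ux => (cg x Ux).2).
  rewrite /fd.
  have E (u : 'rV[R]_N -> R) : (fun x => u x * (a * phi x + psi x)) =
      (fun x => a * (u x * phi x) + u x * psi x).
    by apply/funext => x; ring.
  rewrite (E (fun x => Re (g x))) (E (fun x => Im (g x))).
  rewrite (integral_csupp_linear _ cpr csr) (integral_csupp_linear _ cpi csi).
  by apply/eqP; rewrite eq_complex /=; apply/andP; split; apply/eqP; ring.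
have [M1 M10 gM1] := compact_norm_bound cK KU (fun x Ux => (cg x Ux).1).
have [M2 M20 gM2] := compact_norm_bound cK KU (fun x Ux => (cg x Ux).2).
have [B B0 KB] := compact_box cK.
(* A distribution of order zero: [(2 * B) ^+ N] is the volume of a cube containing [K], and [M1],
   [M2] bound the real and imaginary parts of [g] on [K]. *)
exists ((2 * B) ^+ N * (M1 + M2)), 0%N => phi M sphi p0 pM.
have tphi : test_function U phi by split=> //; exists K.
have pM0 x : `|phi x| <= M by exact: (pM [::]).
have bnd (u : 'rV[R]_N -> R) (L : R) : (forall x, U x -> {for x, continuous u}) ->
    0 <= L -> (forall x, K x -> `|u x| <= L) ->
    `|integral_rV (fun x => u x * phi x)| <= (2 * B) ^+ N * (L * M).
  move=> cu L0 uL; have [cup _] := cont_csupp_test_mul oU tphi cu.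
  apply: integral_rV_bound => // [x i xi|x].
    by rewrite p0 ?mulr0 // => /KB /(_ i); rewrite leNgt xi.
  have [Kx|nKx] := pselect (K x); first by rewrite normrM ler_pM // uL.
  by rewrite p0 // mulr0 normr0 mulr_ge0 // (le_trans _ (pM0 x)).
apply: le_trans (normc_le _ _) _; rewrite lecR.
have := bnd _ _ (fun x Ux => (cg x Ux).1) M10 gM1.
have := bnd _ _ (fun x Ux => (cg x Ux).2) M20 gM2.
by move=> H2 H1; rewrite mulrDr mulrDl -!mulrA; exact: lerD.
Qed.

Lemma smooth_coord (i : 'I_N) : smooth_on setT (fun x : 'rV[R]_N => x 0 i).
Proof.
pose P (h : 'rV[R]_N -> R) := h = (fun x => x 0 i) \/ exists c, h = cst c.
apply: (smooth_class (P := P)); last by left.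
  by move=> _ [->|[c ->]] x; [exact: differentiable_coord | exact:
    differentiable_cst].
move=> _ j [->|[c ->]]; right.
  exists (i == j)%:R; apply/funext => x; rewrite /partial.
  by have [_ ->] := is_derive_coord x i j.
by exists 0; apply/funext => x; rewrite /partial derive_cst.
Qed.

Lemma test_functionM U (a phi : 'rV[R]_N -> R) : smooth_on setT a ->
  test_function U phi -> test_function U (fun x => a x * phi x).
Proof.
move=> sa [sp [K [cK KU p0]]]; split; first exact: smoothM.
by exists K; split=> // x nKx; rewrite p0 // mulr0.
Qed.

Lemma function_distribution_real_mul (a phi : 'rV[R]_N -> R) g :
  fd g (fun x => a x * phi x) = fd (fun x => (a x)%:C%C * g x) phi.
Proof.
rewrite /fd; congr (_ +i* _)%C; congr integral_rV; apply/funext => x.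
  by case: (g x) => ? ? /=; ring.
by case: (g x) => ? ? /=; ring.
Qed.

End ComplexDistributions.

(** * The chain rule for [psi_S \o calF] *)

Section ChainRule.
Variables (R : realType) (n : nat).
Local Notation Psi := (fun p : Heis R n => psi_S (calF p)).
Implicit Types (y z : 'rV[R]_(4 * n)) (p v : 'rV[R]_(4 * n + 3)).

(** [quad_phi] and the entries of [quad_D] are both quadratic forms repeating one 4 x 4 block on
    each quaternion; the bilinear version gives their derivatives by polarization. *)
Definition biform (M : 'M[R]_4) y z : R :=
  \sum_(l < n) \sum_(m < 4) \sum_(j < 4) M m j * y 0 (yidx l m) * z 0 (yidx l j).

Definition phi_mx : 'M[R]_4 := 
  \matrix_(i, j) ((if i == 0%N :> nat then -3 else 1) *+ (i == j :> nat)).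

Lemma quad_phi_biform y : quad_phi y = biform phi_mx y y.
Proof.
apply: eq_bigr => l _.
rewrite !big_ord_recl !big_ord0 !mxE /= !mulr0n !mulr1n.
have E (k : 'I_4) i : nat_of_ord k = i -> forall H,
  yidx l k = yidx l (@Ordinal 4 i H).
  by move=> ki H; congr yidx; exact/val_inj.
rewrite (E ord0 0%N erefl isT) (E (lift ord0 ord0) 1%N erefl isT).
rewrite (E (lift ord0 (lift ord0 ord0)) 2%N erefl isT).
rewrite (E (lift ord0 (lift ord0 (lift ord0 ord0))) 3%N erefl isT).
by rewrite !mul0r !addr0 !add0r; ring.
Qed.

Lemma quad_D_biform y (beta : 'I_3) : quad_D y 0 beta = biform (Dmx R beta) y y.
Proof. by rewrite mxE. Qed.

Lemma biformDl M (s : R) x y z : biform M (s *: x + y) z = s * biform M x z +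
  biform M y z.
Proof.
rewrite /biform mulr_sumr -big_split; apply: eq_bigr => l _ /=.
rewrite mulr_sumr -big_split; apply: eq_bigr => m _ /=.
rewrite mulr_sumr -big_split; apply: eq_bigr => j _ /=.
by rewrite !mxE; ring.
Qed.

Lemma biformDr M (s : R) x y z : biform M x (s *: y + z) = s * biform M x y +
  biform M x z.
Proof.
rewrite /biform mulr_sumr -big_split; apply: eq_bigr => l _ /=.
rewrite mulr_sumr -big_split; apply: eq_bigr => m _ /=.
rewrite mulr_sumr -big_split; apply: eq_bigr => j _ /=.
by rewrite !mxE; ring.
Qed.

Lemma yidx_inj (l l' : 'I_n) (j j' : 'I_4) :
  (yidx l j == yidx l' j') = (l == l') && (j == j').
Proof.
apply/eqP/andP => [/(congr1 val) /= E|[/eqP -> /eqP ->]] //.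
have := ltn_ord j; have := ltn_ord j'; split; apply/eqP/val_inj => /=; lia.
Qed.

Lemma biform_delta_r M y l j :
  biform M y (delta_mx 0 (yidx l j)) = \sum_(m < 4) M m j * y 0 (yidx l m).
Proof.
rewrite /biform (bigD1 l) //= [X in _ + X]big1 ?addr0 => [|l' l'l].
  apply: eq_bigr => m _; rewrite (bigD1 j) //= big1 ?addr0 => [|j' j'j].
    by rewrite mxE !eqxx mulr1.
  by rewrite mxE yidx_inj (negbTE j'j) !andbF mulr0.
apply: big1 => m _; apply: big1 => j' _.
by rewrite mxE yidx_inj (negbTE l'l) andbF mulr0.
Qed.

Lemma biform_delta_l M y l j :
  biform M (delta_mx 0 (yidx l j)) y = \sum_(m < 4) M j m * y 0 (yidx l m).
Proof.
rewrite /biform (bigD1 l) //= [X in _ + X]big1 ?addr0 => [|l' l'l].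
  rewrite (bigD1 j) //= [X in _ + X]big1 ?addr0 => [|j' j'j].
    by apply: eq_bigr => m _; rewrite mxE !eqxx mulr1.
  by apply: big1 => m _; rewrite mxE yidx_inj (negbTE j'j) !andbF mulr0 mul0r.
apply: big1 => m _; apply: big1 => j' _.
by rewrite mxE yidx_inj (negbTE l'l) andbF mulr0 mul0r.
Qed.

Lemma biform0l M y : biform M 0 y = 0.
Proof. by have := biformDl M (-1) 0 0 y; rewrite scaler0 add0r mulN1r addNr. Qed.

Lemma biform0r M y : biform M y 0 = 0.
Proof. by have := biformDr M (-1) y 0 0; rewrite scaler0 add0r mulN1r addNr. Qed.

Definition Hn1_row (y : 'rV[R]_(4 * n)) (c : R) (t : 'rV[R]_3) :
  'rV[R]_(4 * n + 4) :=
  row_mx y (row_mx (c%:M : 'rV[R]_1) t : 'rV[R]_4).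

Definition biform_D (y z : 'rV[R]_(4 * n)) : 'rV[R]_3 :=
  \row_beta biform (Dmx R beta) y z.

Lemma PsiE p : psi_S (calF p) =
  Hn1_row (lsubmx p) (biform phi_mx (lsubmx p) (lsubmx p))
     (rsubmx p + biform_D (lsubmx p) (lsubmx p)).
Proof.
rewrite /psi_S /calF row_mxKl row_mxKr quad_phi_biform /Hn1_row.
by do 3 congr row_mx; congr (_ + _); apply/rowP => b; rewrite quad_D_biform mxE.
Qed.

Lemma Hn1_row_lin (s : R) y c t y' c' t' :
  s *: Hn1_row y c t + Hn1_row y' c' t' = Hn1_row (s *: y + y') (s * c + c') (s *:
    t + t').
Proof.
have E : s *: row_mx (c%:M : 'rV[R]_1) t + row_mx (c'%:M : 'rV[R]_1) t' =
    row_mx ((s * c + c')%:M : 'rV[R]_1) (s *: t + t').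
  by rewrite scale_row_mx add_row_mx scale_scalar_mx -raddfD.
by rewrite /Hn1_row scale_row_mx add_row_mx; congr (row_mx _ _); exact: E.
Qed.

Definition dPsi p v := Hn1_row (lsubmx v)
  (biform phi_mx (lsubmx p) (lsubmx v) + biform phi_mx (lsubmx v) (lsubmx p))
  (rsubmx v + (biform_D (lsubmx p) (lsubmx v) + biform_D (lsubmx v) (lsubmx p))).

Definition d2Psi v :=
  Hn1_row 0 (biform phi_mx (lsubmx v) (lsubmx v)) (biform_D (lsubmx v) (lsubmx v)).

(** The map is polynomial of degree two, so its expansion along a line is exact and the derivative
    can be read off. *)
Lemma Psi_line p v (s : R) : psi_S (calF (s *: v + p)) =
  s ^+ 2 *: d2Psi v + (s *: dPsi p v + psi_S (calF p)).
Proof.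
rewrite !PsiE /dPsi /d2Psi !Hn1_row_lin !linearD /= !linearZ /= scaler0 add0r.
congr Hn1_row; first by rewrite !biformDl !biformDr; ring.
apply/rowP => b; rewrite !mxE !biformDl !biformDr; ring.
Qed.

Lemma is_derive_Psi p v : is_derive p v Psi (dPsi p v).
Proof.
apply: is_derive_cvg.
have -> : (fun s : R => s^-1 *: (psi_S (calF (s *: v + p)) - psi_S (calF p))) =
  (fun s : R => s^-1 *: (s *: (s *: d2Psi v + dPsi p v))).
  apply/funext => s; rewrite Psi_line addrA addrK; congr (_ *: _).
  by rewrite scalerDr scalerA expr2.
have E : \forall s \near (0 : R)^', s *: d2Psi v + dPsi p v =
    s^-1 *: (s *: (s *: d2Psi v + dPsi p v)).
  near=> s; rewrite scalerA mulVf ?scale1r //.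
  by near: s; exact: nbhs_dnbhs_neq.
apply: cvg_trans (near_eq_cvg E) _.
have : s *: d2Psi v + dPsi p v @[s --> (0 : R)^'] --> 0 *: d2Psi v + dPsi p v.
  by apply: cvgD; [apply: cvgZr_tmp; exact: cvg_within | exact: cvg_cst].
by rewrite scale0r add0r.
Unshelve. all: by end_near. Qed.

Lemma Hn1_rowl y c t i : Hn1_row y c t 0 (lshift 4 i) = y 0 i.
Proof. exact: row_mxEl. Qed.

Lemma Hn1_rowr0 y c t : Hn1_row y c t 0 (rshift (4 * n) ord0) = c.
Proof. by rewrite /Hn1_row row_mxEr; exact: (row_cons0 c t). Qed.

Lemma Hn1_rowrS y c t (beta : 'I_3) :
  Hn1_row y c t 0 (rshift (4 * n) (lift ord0 beta)) = t 0 beta.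
Proof. by rewrite /Hn1_row row_mxEr; exact: (row_consS c t beta). Qed.

Lemma Hn1_row_ext (x x' : 'rV[R]_(4 * n + 4)) :
  (forall i, x 0 (lshift 4 i) = x' 0 (lshift 4 i)) ->
  (forall m, x 0 (rshift (4 * n) m) = x' 0 (rshift (4 * n) m)) -> x = x'.
Proof.
move=> xl xr; apply/rowP => k; rewrite -(splitK k).
by case: (fintype.split k) => j; [exact: xl | exact: xr].
Qed.

Lemma differentiable_rV (V : normedModType R) (N : nat) (f : V -> 'rV[R]_N) x :
  (forall i, differentiable (fun u => f u 0 i) x) -> differentiable f x.
Proof.
move=> df; have -> : f = \sum_(i < N) (fun u => f u 0 i *: delta_mx 0 i).
  by apply/funext => u; rewrite fct_sumE -row_sum_delta.
by apply: differentiable_sum => i; exact: differentiableZl.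
Qed.

Lemma differentiable_biform M p :
  differentiable (fun q : 'rV[R]_(4 * n + 3) => biform M (lsubmx q) (lsubmx q)) p.
Proof.
pose c i (q : 'rV[R]_(4 * n + 3)) : R := q 0 (lshift 3 i).
have dc i : differentiable (c i) p by exact: differentiable_coord.
have -> : (fun q => biform M (lsubmx q) (lsubmx q)) =
    \sum_(l < n) \sum_(m < 4) \sum_(j < 4)
      (cst (M m j) * c (yidx l m) * c (yidx l j)).
  apply/funext => q; rewrite fct_sumE; apply: eq_bigr => l _.
  rewrite fct_sumE; apply: eq_bigr => m _; rewrite fct_sumE; apply: eq_bigr => j _.
  by rewrite !mxE.
do 3 (apply: differentiable_sum => ?).
by apply: differentiableM => //; apply: differentiableM => //;
  exact: differentiable_cst.
Qed.

(** The chain rule asks for Fréchet differentiability, beyond the directional derivatives of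
    [is_derive_Psi]; it is checked on the coordinates, which are polynomials. *)
Lemma differentiable_Psi p : differentiable Psi p.
Proof.
apply: differentiable_rV => k; rewrite -(splitK k).
case: (fintype.split k) => [i|m] /=.
  rewrite (_ : (fun _ => _) = fun q : 'rV[R]_(4 * n + 3) => q 0 (lshift 3 i)).
    exact: differentiable_coord.
  by apply/funext => q; rewrite PsiE Hn1_rowl mxE.
case: (unliftP ord0 m) => [b ->|->].
  rewrite (_ : (fun _ => _) = (fun q : 'rV[R]_(4 * n + 3) =>
    q 0 (rshift (4 * n) b)) +
      (fun q => biform (Dmx R b) (lsubmx q) (lsubmx q))).
    apply: differentiableD; [exact: differentiable_coord | exact:
      differentiable_biform].
  by apply/funext => q; rewrite PsiE Hn1_rowrS !mxE.
rewrite (_ : (fun _ => _) = fun q : 'rV[R]_(4 * n + 3) =>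
  biform phi_mx (lsubmx q) (lsubmx q)).
  exact: differentiable_biform.
by apply/funext => q; rewrite PsiE Hn1_rowr0.
Qed.

(** The matrix of the quadratic form giving the entry of index [m] of the last
    quaternion of [psi_S (calF p)]. *)
Definition quad_mx (m : 'I_4) : 'M[R]_4 :=
  if unlift ord0 m is Some beta then Dmx R beta else phi_mx.

(** Each entry of the last quaternion depends on y through a quadratic form with block M, whose
    derivative along the j-th coordinate of a block pairs that block with the j-th column of M +
    M^T. *)
Lemma dPsi_y p l j : dPsi p (delta_mx 0 (lshift 3 (yidx l j))) =
  delta_mx 0 (xidx (widen_ord (leqnSn n) l) j) + \sum_(m < 4)
    (\sum_(k < 4) (quad_mx m k j + quad_mx m j k) * p 0 (lshift 3 (yidx l k))) *:
    delta_mx 0 (xidx ord_max m).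
Proof.
have xl i : xidx (widen_ord (leqnSn n) l) i = lshift 4 (yidx l i) by exact/val_inj.
have xr m : xidx ord_max m = rshift (4 * n) m :> 'I_(4 * n + 4) by exact/val_inj.
have ld : lsubmx (delta_mx 0 (lshift 3 (yidx l j)) : 'rV[R]_(4 * n + 3)) =
    delta_mx 0 (yidx l j).
  by apply/rowP => i; rewrite !mxE eq_lshift.
have rd : rsubmx (delta_mx 0 (lshift 3 (yidx l j)) : 'rV[R]_(4 * n + 3)) = 0.
  by apply/rowP => i; rewrite !mxE eq_rlshift andbF.
rewrite /dPsi ld rd xl.
have sumE i : (\sum_(m < 4)
    (\sum_(k < 4) (quad_mx m k j + quad_mx m j k) * p 0 (lshift 3 (yidx l k))) *:
    delta_mx 0 (xidx ord_max m) : 'rV[R]_(4 * n + 4)) 0 i =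
  \sum_(m < 4)
    (\sum_(k < 4) (quad_mx m k j + quad_mx m j k) * p 0 (lshift 3 (yidx l k))) *
    (i == rshift (4 * n) m)%:R.
  by rewrite summxE; apply: eq_bigr => m _; rewrite !mxE xr.
have dE i : (delta_mx 0 (lshift 4 (yidx l j)) : 'rV[R]_(4 * n + 4)) 0 i =
    (i == lshift 4 (yidx l j))%:R by rewrite mxE eqxx.
have collapse M : biform M (lsubmx p) (delta_mx 0 (yidx l j)) +
    biform M (delta_mx 0 (yidx l j)) (lsubmx p) =
    \sum_(k < 4) (M k j + M j k) * p 0 (lshift 3 (yidx l k)).
  rewrite biform_delta_r biform_delta_l -big_split; apply: eq_bigr => k _ /=.
  by rewrite !mxE; ring.
apply: Hn1_row_ext => [i|m].
  rewrite Hn1_rowl [RHS]mxE sumE !mxE eq_lshift big1 ?addr0 // => m _.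
  by rewrite eq_lrshift mulr0.
rewrite [RHS]mxE sumE dE eq_rlshift [RHS]add0r.
rewrite (bigD1 m) //= [X in _ = _ + X]big1 ?addr0 => [|m' m'm]; last first.
  by rewrite eq_rshift eq_sym (negbTE m'm) mulr0.
rewrite eqxx mulr1 /quad_mx; case: (unliftP ord0 m) => [b ->|->].
  by rewrite Hn1_rowrS !mxE add0r collapse.
by rewrite Hn1_rowr0 collapse.
Qed.

Lemma dPsi_s p (b : 'I_3) : dPsi p (delta_mx 0 (rshift (4 * n) b)) =
  delta_mx 0 (xidx (ord_max : 'I_n.+1) (lift ord0 b)).
Proof.
have xr m : xidx ord_max m = rshift (4 * n) m :> 'I_(4 * n + 4) by exact/val_inj.
have ld : lsubmx (delta_mx 0 (rshift (4 * n) b) : 'rV[R]_(4 * n + 3)) = 0.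
  by apply/rowP => i; rewrite !mxE eq_lrshift andbF.
have rd : rsubmx (delta_mx 0 (rshift (4 * n) b) :
  'rV[R]_(4 * n + 3)) = delta_mx 0 b.
  by apply/rowP => i; rewrite !mxE eq_rshift.
rewrite /dPsi ld rd xr !biform0l !biform0r.
apply: Hn1_row_ext => [i|m]; first by rewrite Hn1_rowl !mxE eq_lrshift andbF.
rewrite [RHS]mxE eq_rshift; case: (unliftP ord0 m) => [b' ->|->].
  by rewrite Hn1_rowrS !mxE !biform0l !biform0r !addr0 (inj_eq lift_inj).
by rewrite Hn1_rowr0 addr0.
Qed.

Lemma partial_Psi (h : 'rV[R]_(4 * n + 4) -> R) p i :
  differentiable h (psi_S (calF p)) ->
  partial i (fun q => h (psi_S (calF q))) p =
  'd h (psi_S (calF p)) (dPsi p (delta_mx 0 i)).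
Proof.
move=> dh; rewrite /partial deriveE; last first.
  exact: (differentiable_comp (differentiable_Psi p) dh).
rewrite (diff_comp (differentiable_Psi p) dh) /=; congr ('d _ _ _).
rewrite -deriveE; last exact: differentiable_Psi.
by have [_ ->] := is_derive_Psi p (delta_mx 0 i).
Qed.

Lemma partial_Psi_y (h : 'rV[R]_(4 * n + 4) -> R) p l j :
  differentiable h (psi_S (calF p)) ->
  partial (lshift 3 (yidx l j)) (fun q => h (psi_S (calF q))) p =
  partial (xidx (widen_ord (leqnSn n) l) j) h (psi_S (calF p)) + \sum_(m < 4)
    (\sum_(k < 4) (quad_mx m k j + quad_mx m j k) * p 0 (lshift 3 (yidx l k))) *
    partial (xidx ord_max m) h (psi_S (calF p)).
Proof.
move=> dh; rewrite partial_Psi // dPsi_y linearD linear_sum /partial deriveE //.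
congr (_ + _); apply: eq_bigr => m _; rewrite linearZ deriveE //.
Qed.

Lemma partial_Psi_s (h : 'rV[R]_(4 * n + 4) -> R) p b :
  differentiable h (psi_S (calF p)) ->
  partial (rshift (4 * n) b) (fun q => h (psi_S (calF q))) p =
  partial (xidx ord_max (lift ord0 b)) h (psi_S (calF p)).
Proof. by move=> dh; rewrite partial_Psi // dPsi_s /partial deriveE. Qed.

End ChainRule.

(** * Pushforward of the vector fields [Y] *)

Section Spinors.
Variable R : realType.
Implicit Types (d F G : 'I_4 -> R[i]).

Definition spin d (e b : bool) : R[i] :=
  match e, b with
  | false, false => - d (@Ordinal 4 2 isT) - 'i%C * d (@Ordinal 4 3 isT)
  | false, true  => - d (@Ordinal 4 0 isT) - 'i%C * d (@Ordinal 4 1 isT)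
  | true,  false =>   d (@Ordinal 4 0 isT) - 'i%C * d (@Ordinal 4 1 isT)
  | true,  true  => - d (@Ordinal 4 2 isT) + 'i%C * d (@Ordinal 4 3 isT)
  end.

Lemma spinor_opE (N : nat) (D : 'I_4 -> functional R N ->
  functional R N) e b T phi :
  spinor_op D e b T phi = spin (fun j => D j T phi) e b.
Proof. by case: e; case: b. Qed.

(** Treats the four operators uniformly: continuity and linearity of [spin] reduce to the case
    [a * g + h], used twice, with final term 0. *)
Lemma spin_lin e b : exists u v j k, forall d, spin d e b = u * d j + (v * d k + 0).
Proof.
case: e; case: b.
- by exists (-1), 'i%C, (@Ordinal 4 2 isT), (@Ordinal 4 3 isT) => d /=; ring.
- by exists 1, (- 'i%C), (@Ordinal 4 0 isT), (@Ordinal 4 1 isT) => d /=; ring.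
- by exists (-1), (- 'i%C), (@Ordinal 4 0 isT), (@Ordinal 4 1 isT) => d /=; ring.
- by exists (-1), (- 'i%C), (@Ordinal 4 2 isT), (@Ordinal 4 3 isT) => d /=; ring.
Qed.

(** The vector fields [Y_(4l+j)] are pushed forward to these combinations of
    [F j = d/dx_(4l+j)] and [G m = d/dx_(4n+m)]. *)
Definition pushed (y : 'I_4 -> R) F G (j : 'I_4) : R[i] :=
  2 * \sum_(beta < 3) \sum_(m < 4)
    (Bmx R beta m j)%:C%C * ((y m)%:C%C * G (lift ord0 beta)) +
  (F j + \sum_(m < 4)
    (\sum_(k < 4) (quad_mx R m k j + quad_mx R m j k) * y k)%:C%C * G m).

(** Equivalent to [Bmx] being the antisymmetric part of [Cmx], as [Dmx] is its symmetric part;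
    verified entry by entry. *)
Lemma tangent_coef (beta : 'I_3) (m j : 'I_4) :
  2 * Bmx R beta m j + (Dmx R beta m j + Dmx R beta j m) = 2 * Cmx R beta m j.
Proof.
rewrite /Dmx !mxE.
case: beta => -[|[|[|//]]] ? /=; case: m => -[|[|[|[|//]]]] ?;
  case: j => -[|[|[|[|//]]]] ?; rewrite !mxE /=; lra.
Qed.

Local Notation o0 := (@Ordinal 4 0 isT).
Local Notation o1 := (@Ordinal 4 1 isT).
Local Notation o2 := (@Ordinal 4 2 isT).
Local Notation o3 := (@Ordinal 4 3 isT).

Lemma sum_ord4 (V : nmodType) (H : 'I_4 -> V) :
  \sum_(m < 4) H m = H o0 + (H o1 + (H o2 + H o3)).
Proof.
rewrite !big_ord_recl big_ord0 addr0.
by congr (_ + (_ + (_ + _))); congr H; exact/val_inj.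
Qed.

Lemma sum_ord3 (V : nmodType) (H : 'I_3 -> V) : \sum_(m < 3) H m =
  H (@Ordinal 3 0 isT) + (H (@Ordinal 3 1 isT) + H (@Ordinal 3 2 isT)).
Proof.
rewrite !big_ord_recl big_ord0 addr0.
by congr (_ + (_ + _)); congr H; exact/val_inj.
Qed.

(** [G ord0] differentiates in the real part of the last quaternion, so it carries the gradient of
    the diagonal form phi. In the three imaginary directions the group term and the shear combine
    into [Cmx]. *)
Lemma pushedE y F G j : pushed y F G j = F j +
  ((2 * phi_mx R j j * y j)%:C%C * G ord0 + \sum_(beta < 3)
    (2 * \sum_(m < 4) Cmx R beta m j * y m)%:C%C * G (lift ord0 beta)).
Proof.
rewrite /pushed addrC -addrA; congr (_ + _).
rewrite big_ord_recl -addrA; congr (_ + _).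
  congr (_%:C%C * _); rewrite (bigD1 j) //= big1 ?addr0 => [|k kj].
    by rewrite /quad_mx unlift_none; ring.
  have kj' : (k == j :> nat) = false by exact/negbTE.
  have jk' : (j == k :> nat) = false by rewrite eq_sym.
  by rewrite /quad_mx unlift_none !mxE kj' jk' !mulr0n addr0 mul0r.
rewrite mulr_sumr -big_split; apply: eq_bigr => beta _ /=.
rewrite /quad_mx liftK.
have -> : \sum_(m < 4) (Bmx R beta m j)%:C%C * ((y m)%:C%C * G (lift ord0 beta)) =
    (\sum_(m < 4) Bmx R beta m j * y m)%:C%C * G (lift ord0 beta).
  rewrite rmorph_sum mulr_suml; apply: eq_bigr => m _.
  by rewrite rmorphM mulrA.
rewrite mulrA -mulrDl; congr (_ * _).
have -> : 2 = (2 : R)%:C%C by rewrite rmorph_nat.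
rewrite -rmorphM -rmorphD; congr (_%:C)%C.
rewrite !mulr_sumr -big_split; apply: eq_bigr => m _ /=.
by rewrite !mulrA -tangent_coef; ring.
Qed.

Lemma pushed_table y F G :
  [/\ pushed y F G o0 = F o0 + (2 : R)%:C%C * ((- 3 * y o0)%:C%C * G o0 +
        (- y o1)%:C%C * G o1 + (- y o2)%:C%C * G o2 + (- y o3)%:C%C * G o3),
      pushed y F G o1 = F o1 + (2 : R)%:C%C * ((y o1)%:C%C * G o0 +
        (- 3 * y o0)%:C%C * G o1 + (- y o3)%:C%C * G o2 + (y o2)%:C%C * G o3),
      pushed y F G o2 = F o2 + (2 : R)%:C%C * ((y o2)%:C%C * G o0 +
        (y o3)%:C%C * G o1 + (- 3 * y o0)%:C%C * G o2 + (- y o1)%:C%C * G o3) &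
      pushed y F G o3 = F o3 + (2 : R)%:C%C * ((y o3)%:C%C * G o0 +
        (- y o2)%:C%C * G o1 + (y o1)%:C%C * G o2 + (- 3 * y o0)%:C%C * G o3)].
Proof.
have l0 : lift ord0 (@Ordinal 3 0 isT) = o1 by exact/val_inj.
have l1 : lift ord0 (@Ordinal 3 1 isT) = o2 by exact/val_inj.
have l2 : lift ord0 (@Ordinal 3 2 isT) = o3 by exact/val_inj.
have z0 : ord0 = o0 by exact/val_inj.
split; rewrite pushedE sum_ord3 l0 l1 l2 z0 !sum_ord4 !mxE /=; ring.
Qed.

(** The key identity: [u] and [v] do not depend on the primed index [b], so that
    contracting with it gives a combination of the equations of [f]. *)
Lemma spin_pushed (y : 'I_4 -> R) (e : bool) : exists u v, forall F G b,
  spin (pushed y F G) e b = spin F e b + (u * spin G false b + v * spin G true b).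
Proof.
pose c (a b : R) : R[i] := (2 * a +i* (2 * b))%C.
(* These are - nabla_A^(1) phi and nabla_A^(0) phi on the block [y], where A has parity [e]; the 2
   in [c] comes from differentiating squares. *)
exists (if e then c (y o2) (- y o3) else c (-3 * y o0) (y o1)),
       (if e then c (-3 * y o0) (- y o1) else c (- y o2) (- y o3)) => F G b.
have [p0 p1 p2 p3] := pushed_table y F G.
rewrite /c; case: e; case: b; rewrite /spin ?p0 ?p1 ?p2 ?p3;
  case: (F o0) => ? ?; case: (F o1) => ? ?; case: (F o2) => ? ?;
    case: (F o3) => ? ?;
  case: (G o0) => ? ?; case: (G o1) => ? ?; case: (G o2) => ? ?;
    case: (G o3) => ? ?;
  by apply/eqP; rewrite eq_complex /=; apply/andP; split; apply/eqP; ring.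
Qed.

End Spinors.

(** * The pullback *)

Section Pullback.
Variables (R : realType) (n : nat).
Local Notation fd := function_distribution.
Local Notation Re := complex.Re.
Local Notation Im := complex.Im.
Local Notation Psi := (fun p : Heis R n => psi_S (calF p)).

(** * Further rules for distributions given by functions *)

Section FunctionDistributions.
Variable N : nat.
Implicit Types (V : set 'rV[R]_N) (g h : 'rV[R]_N -> R[i]).

Lemma function_distribution_eq V g h phi : test_function V phi ->
  (forall x, V x -> g x = h x) ->
  fd g phi = fd h phi.
Proof.
move=> [_ [K [_ KV p0]]] gh; rewrite /fd; congr (_ +i* _)%C; congr integral_rV;
  apply/funext => x; have [Kx|nKx] := pselect (K x);
  by rewrite ?(gh _ (KV _ Kx)) // p0 // !mulr0.
Qed.

Lemma ccontinuous_on_eq V g h : open V -> (forall x, V x -> g x = h x) ->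
  ccontinuous_on V h -> ccontinuous_on V g.
Proof.
move=> oV gh ch x Vx; have [hr hi] := ch x Vx.
have E : \forall y \near x, h y = g y.
  have := open_nbhs_nbhs (conj oV Vx).
  by apply: filter_app; near=> y => Vy; rewrite gh.
split.
  have Er : \forall y \near x, Re (h y) = Re (g y).
    by apply: filter_app E; near=> y => ->.
  by rewrite /prop_for /continuous_at gh //; apply: cvg_trans (near_eq_cvg Er) hr.
have Ei : \forall y \near x, Im (h y) = Im (g y).
  by apply: filter_app E; near=> y => ->.
by rewrite /prop_for /continuous_at gh //; apply: cvg_trans (near_eq_cvg Ei) hi.
Unshelve. all: by end_near. Qed.

Lemma function_distributionZ V (a : R[i]) g phi : open V ->
  test_function V phi -> ccontinuous_on V g ->
  fd (fun x => a * g x) phi = a * fd g phi.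
Proof.
move=> oV tphi cg; have := function_distribution_lin oV tphi a cg
  (@ccontinuous_on_cst _ _ V 0).
rewrite (function_distribution0 oV tphi) addr0 => <-; congr (fd _ _).
by apply/funext => x; rewrite addr0.
Qed.

Lemma ccontinuous_onZ V (a : R[i]) g : ccontinuous_on V g ->
  ccontinuous_on V (fun x => a * g x).
Proof.
move=> cg; have := ccontinuous_on_lin a cg (@ccontinuous_on_cst _ _ V 0);
  congr ccontinuous_on.
by apply/funext => x; rewrite addr0.
Qed.

Lemma ccontinuous_onD V g h : ccontinuous_on V g -> ccontinuous_on V h ->
  ccontinuous_on V (fun x => g x + h x).
Proof.
move=> cg ch; have := ccontinuous_on_lin 1 cg ch; congr ccontinuous_on.
by apply/funext => x; rewrite mul1r.
Qed.

Lemma ccontinuous_on_spin V (G : 'I_4 -> 'rV[R]_N -> R[i]) e b :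
  (forall j, ccontinuous_on V (G j)) -> ccontinuous_on V (fun x => spin (fun j =>
    G j x) e b).
Proof.
move=> cG; have [u [v [j [k E]]]] := spin_lin R e b.
under [X in ccontinuous_on _ X]eq_fun do rewrite E.
exact: (ccontinuous_on_lin u (cG j) (ccontinuous_on_lin v (cG k)
  (@ccontinuous_on_cst _ _ V 0))).
Qed.

Lemma function_distribution_spin V (G : 'I_4 -> 'rV[R]_N -> R[i]) e b phi :
  open V -> test_function V phi -> (forall j, ccontinuous_on V (G j)) ->
  fd (fun x => spin (fun j => G j x) e b) phi = spin (fun j => fd (G j) phi) e b.
Proof.
move=> oV tphi cG; have [u [v [j [k E]]]] := spin_lin R e b.
have -> : (fun x => spin (fun j => G j x) e b) =
    (fun x => u * G j x + (v * G k x + 0)) by apply/funext => x; exact: E.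
have c0 : ccontinuous_on V (fun=> 0) by exact: ccontinuous_on_cst.
rewrite (function_distribution_lin oV tphi u (cG j) (ccontinuous_on_lin v (cG k)
  c0)).
by rewrite (function_distribution_lin oV tphi v (cG k) c0) (function_distribution0
  oV tphi) E.
Qed.

End FunctionDistributions.

Lemma complex_lin_comb (I : finType) (a u v : I -> R) (x y : R) :
  ((x + \sum_i a i * u i) +i* (y + \sum_i a i * v i))%C =
  (x +i* y)%C + \sum_i (a i)%:C%C * (u i +i* v i)%C.
Proof.
have -> : \sum_i (a i)%:C%C * (u i +i* v i)%C =
    ((\sum_i a i * u i) +i* (\sum_i a i * v i))%C.
  apply: (big_rec3 (fun (c : R[i]) p q => c = (p +i* q)%C)) => // i c p q _ ->.
  by apply/eqP; rewrite eq_complex /= !mul0r subr0 addr0 !eqxx.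
by [].
Qed.

Lemma sum_lin_comb_eq0 (I : finType) (u v : R[i]) (S T W : I -> R[i]) :
  \sum_i S i = 0 -> \sum_i T i = 0 -> \sum_i W i = 0 ->
  \sum_i (S i + (u * T i + v * W i)) = 0.
Proof.
by move=> S0 T0 W0; rewrite !big_split -!mulr_sumr S0 T0 W0 /= !mulr0 !addr0.
Qed.

(** * From the equations of [f] to those of its pullback *)

Section Regular.
Variables (k : nat) (U : set 'rV[R]_(4 * n + 4)).
Variable f : k.+1.-tuple bool -> 'rV[R]_(4 * n + 4) -> R[i].
Hypotheses (oU : open U) (f_smooth : forall A, csmooth_on U (f A)).
Hypothesis f_regular : @k_regular R n k U (fun A => fd (f A)).

Lemma regular_pointwise (l : 'I_n.+1) e (A : k.-tuple bool) x : U x ->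
  \sum_(b : bool) spin (fun j => cpartial (xidx l j) (f [tuple of b :: A]) x) e b =
    0.
Proof.
have df B := csmooth_cC1 (f_smooth B).
have cs b : ccontinuous_on U (fun x =>
    spin (fun j => cpartial (xidx l j) (f [tuple of b :: A]) x) e b).
  by apply: ccontinuous_on_spin => j; have [_ _] := df [tuple of b :: A]; exact.
move: x; apply: (function_distribution_eq0 (g := fun x => \sum_(b : bool)
    spin (fun j => cpartial (xidx l j) (f [tuple of b :: A]) x) e b) oU).
  exact: ccontinuous_on_sum.
move=> phi tphi; rewrite (function_distribution_sum oU tphi) //.
have [_ reg] := f_regular; apply: etrans (reg l e A phi tphi).
apply: eq_bigr => b _; rewrite /nabla spinor_opE (function_distribution_spin _ _ oU
  tphi); last first.
  by move=> j; have [_ _] := df [tuple of b :: A]; exact.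
by congr spin; apply/funext => j; rewrite (dpartial_function_distribution oU tphi).
Qed.

(** Symmetry is assumed for the distributions on [U]; only its pointwise form, which continuity
    provides, survives restriction to the hypersurface. *)
Lemma symmetric_pointwise (A B : k.+1.-tuple bool) x : perm_eq A B -> U x ->
  f A x = f B x.
Proof.
move=> AB Ux; apply/eqP; rewrite -subr_eq0 -opprB oppr_eq0; apply/eqP.
have cf A' := cC1_ccontinuous (csmooth_cC1 (f_smooth A')).
have := function_distribution_eq0 oU (ccontinuous_on_lin (-1) (cf A) (cf B)) _ Ux.
rewrite mulN1r addrC; apply => phi tphi.
have [[_ sf] _] := f_regular.
by rewrite (function_distribution_lin oU tphi) // (sf _ _ AB _ tphi) mulN1r addNr.
Qed.

Definition pullback_domain : set 'rV[R]_(4 * n + 3) := [set p | U (psi_S (calF p))].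

Lemma open_pullback_domain : open pullback_domain.
Proof.
apply: (open_comp (f := Psi)) => // p _.
exact: differentiable_continuous (differentiable_Psi p).
Qed.

Lemma ccontinuous_on_Psi (g : 'rV[R]_(4 * n + 4) -> R[i]) : ccontinuous_on U g ->
  ccontinuous_on pullback_domain (fun p => g (psi_S (calF p))).
Proof.
move=> cg p Vp; have [gr gi] := cg _ Vp.
have cP := differentiable_continuous (differentiable_Psi p).
by split; [exact (continuous_comp (f := Psi) cP gr)
          |exact (continuous_comp (f := Psi) cP gi)].
Qed.

Section Component.
Variable A : k.+1.-tuple bool.
Local Notation g := (fun p => f A (psi_S (calF p))).

Lemma cpartial_Psi_y (p : 'rV[R]_(4 * n + 3)) l j : pullback_domain p ->
  cpartial (lshift 3 (yidx l j)) g p =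
  cpartial (xidx (widen_ord (leqnSn n) l) j) (f A) (psi_S (calF p)) + \sum_(m < 4)
    (\sum_(k < 4) (quad_mx R m k j + quad_mx R m j k) *
       p 0 (lshift 3 (yidx l k)))%:C%C *
    cpartial (xidx ord_max m) (f A) (psi_S (calF p)).
Proof.
move=> Vp; have [dr di _] := csmooth_cC1 (f_smooth A).
rewrite /cpartial (partial_Psi_y _ _ (dr _ Vp)) (partial_Psi_y _ _ (di _ Vp)).
exact: complex_lin_comb.
Qed.

Lemma cpartial_Psi_s (p : 'rV[R]_(4 * n + 3)) b : pullback_domain p ->
  cpartial (rshift (4 * n) b) g p =
  cpartial (xidx ord_max (lift ord0 b)) (f A) (psi_S (calF p)).
Proof.
move=> Vp; have [dr di _] := csmooth_cC1 (f_smooth A).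
by rewrite /cpartial (partial_Psi_s _ (dr _ Vp)) (partial_Psi_s _ (di _ Vp)).
Qed.

Lemma yidx_surj (i : 'I_(4 * n)) : exists l j, i = yidx l j.
Proof.
have l4 : (i %/ 4 < n)%N by rewrite ltn_divLR // [(n * 4)%N]mulnC ltn_ord.
exists (Ordinal l4), (Ordinal (ltn_pmod i (isT : 0 < 4)%N)).
by apply/val_inj; rewrite /= [(4 * (_ %/ _))%N]mulnC -divn_eq.
Qed.

(** Continuity of the derivatives is read off from the chain rule formulas, valid on the open
    pullback domain: continuous coefficients times derivatives of [f A] composed with a continuous
    map. *)
Lemma cC1_Psi : cC1_on pullback_domain g.
Proof.
have [dr di cp] := csmooth_cC1 (f_smooth A).
split=> [p Vp|p Vp|i].
- exact: (differentiable_comp (differentiable_Psi p) (dr _ Vp)).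
- exact: (differentiable_comp (differentiable_Psi p) (di _ Vp)).
rewrite -(splitK i); case: (fintype.split i) => [i'|b] /=.
  have [l [j ->]] := yidx_surj i'.
  apply: (ccontinuous_on_eq open_pullback_domain (fun p => @cpartial_Psi_y p l j)).
  apply: ccontinuous_onD; first exact: ccontinuous_on_Psi (cp _).
  apply: ccontinuous_on_sum => m; apply: ccontinuous_on_real_mul;
    last exact: ccontinuous_on_Psi (cp _).
  have -> : (fun p : 'rV[R]_(4 * n + 3) =>
      \sum_(k < 4) (quad_mx R m k j + quad_mx R m j k) *
       p 0 (lshift 3 (yidx l k))) = \sum_(k < 4) (fun p : 'rV[R]_(4 * n + 3) =>
       (quad_mx R m k j + quad_mx R m j k) * p 0 (lshift 3 (yidx l k)) + 0).
    by apply/funext => p; rewrite fct_sumE; apply: eq_bigr => *; rewrite addr0.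
  elim/big_ind: _ => [|u v cu cv p|q _].
  - exact: cst_continuous.
  - exact: (continuousD (cu p) (cv p)).
  - by apply: continuous_lin; [exact: coord_continuous | exact: cst_continuous].
apply: (ccontinuous_on_eq open_pullback_domain (fun p => @cpartial_Psi_s p b)).
exact: ccontinuous_on_Psi (cp _).
Qed.

Definition Ypushed (l : 'I_n) (j : 'I_4) (p : 'rV[R]_(4 * n + 3)) : R[i] :=
  pushed (fun m => p 0 (lshift 3 (yidx l m)))
    (fun j => cpartial (xidx (widen_ord (leqnSn n) l) j) (f A) (psi_S (calF p)))
    (fun m => cpartial (xidx ord_max m) (f A) (psi_S (calF p))) j.

(** The value of the field [Y l j] on the pullback, with the sum put first so that linearity in the
    form [a * g + h] applies with [a = 2]. *)
Definition Ypt (l : 'I_n) (j : 'I_4) (p : 'rV[R]_(4 * n + 3)) : R[i] :=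
  2 * \sum_(beta < 3) \sum_(m < 4)
    (Bmx R beta m j)%:C%C * ((p 0 (lshift 3 (yidx l m)))%:C%C *
      cpartial (rshift (4 * n) beta) g p) +
  cpartial (lshift 3 (yidx l j)) g p.

Lemma Ypt_pushed l j p : pullback_domain p -> Ypt l j p = Ypushed l j p.
Proof.
move=> Vp; rewrite /Ypt (cpartial_Psi_y l j Vp) /Ypushed /pushed.
apply: (f_equal2 +%R); last by []; apply: (f_equal ( *%R 2)).
apply: eq_bigr => b _; apply: eq_bigr => m _.
by rewrite (cpartial_Psi_s b Vp).
Qed.

Lemma ccontinuous_on_coord_mul i h : ccontinuous_on pullback_domain h ->
  ccontinuous_on pullback_domain (fun p => (p 0 i)%:C%C * h p).
Proof. by apply: ccontinuous_on_real_mul; exact: coord_continuous. Qed.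

Lemma ccontinuous_on_Ypt_sum l j : ccontinuous_on pullback_domain (fun p =>
  \sum_(beta < 3) \sum_(m < 4)
    (Bmx R beta m j)%:C%C * ((p 0 (lshift 3 (yidx l m)))%:C%C *
      cpartial (rshift (4 * n) beta) g p)).
Proof.
have [_ _ cp] := cC1_Psi.
do 2 (apply: ccontinuous_on_sum => ?); apply: ccontinuous_onZ;
  exact: ccontinuous_on_coord_mul.
Qed.

Lemma ccontinuous_on_Ypt l j : ccontinuous_on pullback_domain (Ypt l j).
Proof.
by have [_ _ cp] := cC1_Psi; apply: ccontinuous_on_lin => //;
  exact: ccontinuous_on_Ypt_sum.
Qed.

Lemma Y_function_distribution l j phi : test_function pullback_domain phi ->
  Y l j (fd g) phi = fd (Ypt l j) phi.
Proof.
move=> tphi; have oV := open_pullback_domain; have dg := cC1_Psi;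
  have [_ _ cp] := dg.
rewrite /Ypt (function_distribution_lin oV tphi) //;
  last exact: ccontinuous_on_Ypt_sum.
rewrite /Y addrC (dpartial_function_distribution oV tphi) //; congr (2 * _ + _).
rewrite (function_distribution_sum oV tphi) => [|b]; last first.
  by apply: ccontinuous_on_sum => m; apply: ccontinuous_onZ;
    exact: ccontinuous_on_coord_mul.
apply: eq_bigr => b _.
rewrite (function_distribution_sum oV tphi) => [|m]; last first.
  by apply: ccontinuous_onZ; exact: ccontinuous_on_coord_mul.
apply: eq_bigr => m _; rewrite (function_distributionZ _ oV tphi);
  last exact: ccontinuous_on_coord_mul.
(* In [Y] the coordinate multiplies the test function; the product is again a test function, so the
   integration by parts applies to it as it stands. *)
rewrite /dmul -function_distribution_real_mul (dpartial_function_distribution oV)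
  //.
by apply: test_functionM => //; exact: smooth_coord.
Qed.

End Component.

Lemma CF_pointwise l e (A : k.-tuple bool) p : pullback_domain p ->
  \sum_(b : bool) spin (fun j => Ypt [tuple of b :: A] l j p) e b = 0.
Proof.
move=> Vp.
have [u [v E]] := spin_pushed (fun m => p 0 (lshift 3 (yidx l m))) e.
rewrite (eq_bigr _ (fun b _ => etrans (congr1 (fun d => spin d e b)
  (funext (fun j => @Ypt_pushed [tuple of b :: A] l j p Vp))) (E _ _ b))).
by apply: sum_lin_comb_eq0; exact: regular_pointwise.
Qed.

Lemma pullback_CF : k_CF pullback_domain (fun A => fd (fun p =>
  f A (psi_S (calF p)))).
Proof.
have oV := open_pullback_domain.
split; first split=> [A|A B AB phi tphi].
- by apply: is_distribution_function_distribution => //;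
    exact: cC1_ccontinuous (cC1_Psi A).
- by apply: (function_distribution_eq tphi) => p Vp; exact: symmetric_pointwise.
move=> l e A phi tphi.
under eq_bigr => b _.
  rewrite /Z spinor_opE.
  rewrite (_ : (fun j => Y l j _ phi) = fun j =>
    fd (Ypt [tuple of b :: A] l j) phi);
    last by apply/funext => j; exact: Y_function_distribution.
  rewrite -(function_distribution_spin _ _ oV tphi); last by move=> j;
    exact: ccontinuous_on_Ypt.
  over.
rewrite -(function_distribution_sum oV tphi) => [|b];
  last by apply: ccontinuous_on_spin => j; exact: ccontinuous_on_Ypt.
rewrite -[RHS](function_distribution0 oV tphi);
  apply: (function_distribution_eq tphi) => p Vp; exact: CF_pointwise.
Qed.

End Regular.
End Pullback.

Theorem proposition5p3 (R : realType) (n k : nat)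
    (U : set 'rV[R]_(4 * n + 4)) (q0 : 'rV[R]_(4 * n + 4))
    (f : k.+1.-tuple bool -> 'rV[R]_(4 * n + 4) -> R[i])
    (U_open : open U) (Uq0 : U q0) (Sq0 : hypersurface q0)
    (f_smooth : forall A, csmooth_on U (f A))
    (f_regular : k_regular U (fun A => function_distribution (f A))) :
  exists V : set 'rV[R]_(4 * n + 3),
    [/\ open V,
        V (calF_inv (pi_S q0)),
        (forall p, V p -> U (psi_S (calF p)))
      & k_CF V (fun A => function_distribution (fun p => f A (psi_S (calF p))))].
Proof.
exists (pullback_domain U); split=> //.
- exact: open_pullback_domain.
(* As [q0] lies on the hypersurface, [psi_S] undoes [pi_S] there, so the base point is sent back to
   [q0], which is in [U]. *)
- by rewrite /pullback_domain /= calF_invK pi_SK // mem_set.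
- exact: pullback_CF.
Qed.
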